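(* Let $\lambda$ be an infinite cardinal, $k\ge 2$ an integer, and let $\psi_k^\lambda$ be the sentence of $L_{(2^\lambda)^+,\omega}$ defined in the context. Then $\psi_k^\lambda$ is not categorical in any cardinal $\kappa\ge\beth_{k+1}(\lambda)^+$.
   Context: Fix an infinite cardinal $\lambda$ and an integer $k\ge 2$. For a set $A$ and $n\in\mathbb N$, $[A]^n$ denotes the set of $n$-tuples of elements of $A$ without repetition. $\beth_0(\lambda)=\lambda$, $\beth_{n+1}(\lambda)=2^{\beth_n(\lambda)}$. Basic objects. $S=[\lambda]^{<\aleph_0}$ is the set of finite subsets of $\lambda$. $\mathfrak D$ is the filter on $S$ consisting of those $A\subseteq S$ for which there is $u_A\in S$ such that every $v\in S$ with $u_A\subseteq v$ lies in $A$. $G^+={}^S(\mathbb Z_2)$ is the group of all functions $S\to\mathbb Z_2$ under pointwise addition, and $G=\{f\in G^+:\{u\in S:f(u)=0\}\in\mathfrak D\}$, a subgroup. For a set $I$, $H_I$ is the group of functions $[I]^k\to\mathbb Z_2$ with finite support, under pointwise addition. The structure $M_I$. Its universe is the disjoint union $I\cup[I]^k\cup[I]^{k+1}\cup([I]^k\times S\times H_I)\cup([I]^k\times S\times\mathbb Z_2)\cup H_I\cup([I]^{k+1}\times G)$. It has predicates $P_0=I$, $P_{1,1}=[I]^k$, $P_{1,2}=[I]^{k+1}$, $P_2=[I]^k\times S\times H_I$, $P_{2,s}=[I]^k\times\{s\}\times H_I$ ($s\in S$), $P_3=[I]^k\times S\times\mathbb Z_2$, $P_{3,s}=[I]^k\times\{s\}\times\mathbb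 Z_2$ ($s\in S$), $P_4=H_I$, $P_5=[I]^{k+1}\times G$; coordinate projections $\pi^0_\ell:P_{1,1}\to P_0$ ($\ell<k$) and $\pi^1_\ell:P_{1,2}\to P_0$ ($\ell<k+1$), $\ell$-th coordinate; partial functions $F_2(u,s,h)=u$ on $P_2$, $F_3(u,s,i)=u$ on $P_3$, $F_5(u,g)=u$ on $P_5$, $F_{3,g^*}(u,g)=(u,g^*+g)$ on $P_5$ for each $g^*\in G$, and $F_4((v,s,h),h_1)=(v,s,h+h_1)$ on $P_2\times P_4$; and, for each $s\in S$, a $(3k+4)$-ary predicate $Q_s$, the set of all tuples $\langle a_0,\dots,a_k,u_0,\dots,u_k,x_0,\dots,x_{k-1},y_k,z\rangle$ such that: the $a_\ell\in I$ ($\ell\le k$) are pairwise distinct; $u_\ell=\langle a_m:m\ne\ell\rangle\in[I]^k$ ($\ell\le k$); $y_k=(u_k,s,h_k)$ for some $h_k\in H_I$; $x_\ell=(u_\ell,s,i_\ell)$ with $i_\ell\in\mathbb Z_2$ ($\ell<k$); $z=(u,g)$ with $u=(a_0,\dots,a_k)$ and $g\in G$; and $\mathbb Z_2\models\sum_{\ell<k}i_\ell=h_k(u_0)+g(s)$. Let $\tau$ be the vocabulary of $M_I$. The sentence. $\psi_k^\lambda\in L_{(2^\lambda)^+,\omega}(\tau)$ is the conjunction of the first order theory $T_0$ of $M_I$ (for infinite $I$) with the sentences $\forall z_1z_2\big([P_5(z_1)\wedge P_5(z_2)\wedge F_5(z_1)=F_5(z_2)]\to\bigvee_{g^*\in G}F_{3,g^*}(z_1)=z_2\big)$,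 $\forall y(P_2(y)\leftrightarrow\bigvee_{s\in S}P_{2,s}(y))$ and $\forall y(P_3(y)\leftrightarrow\bigvee_{s\in S}P_{3,s}(y))$. $\psi_k^\lambda$ is categorical in a cardinal $\kappa$ if it has exactly one model of cardinality $\kappa$ up to isomorphism. *)

(* Defs.v *)
From mathcomp Require Import all_boot all_order all_algebra.
From mathcomp Require Import boolp classical_sets functions cardinality.

Set Implicit Arguments.
Unset Strict Implicit.
Unset Printing Implicit Defensive.

Import GRing.Theory.
Local Open Scope classical_set_scope.
Local Open Scope card_scope.

(* A type stands for its cardinality. *)

Definition card_le_type (A B : Type) : Prop := [set: A] #<= [set: B].
Definition card_lt_type (A B : Type) : Prop :=
  card_le_type A B /\ ~ card_le_type B A.
Definition card_eq_type (A B : Type) : Prop := [set: A] #= [set: B].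

Definition infinite_type (A : Type) : Prop := infinite_set [set: A].

(* B has cardinality |A|^+ *)
Definition is_card_succ (A B : Type) : Prop :=
  card_lt_type A B /\ forall C : Type, card_lt_type A C -> card_le_type B C.

Fixpoint beth (n : nat) (A : Type) : Type :=
  if n is n'.+1 then beth n' A -> bool else A.

(* Function symbols are interpreted by partial functions, None meaning undefined.
   An isomorphism preserves the domains of definition. *)

Record vocabulary := Vocabulary {
  fsym : Type;
  rsym : Type;
  farity : fsym -> nat;
  rarity : rsym -> nat
}.

Record structure (tau : vocabulary) := Structure {
  carrier :> Type;
  funI : forall f : fsym tau, ('I_(farity f) -> carrier) -> option carrier;
  relI : forall r : rsym tau, ('I_(rarity r) -> carrier) -> Prop
}.

Definition isomorphic (tau : vocabulary) (M N : structure tau) : Prop :=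
  exists h : M -> N,
    [/\ bijective h,
        forall (f : fsym tau) (x : 'I_(farity f) -> M),
          funI (h \o x) = omap h (funI x)
      & forall (r : rsym tau) (x : 'I_(rarity r) -> M),
          relI (h \o x) <-> relI x].

(* The free variables of a term n or a formula n are indexed by 'I_n; sentences
   are formulas with n = 0. *)

Section Logic.
Variable tau : vocabulary.

Inductive term (n : nat) : Type :=
| Var of 'I_n
| App (f : fsym tau) of ('I_(farity f) -> term n).

Inductive atomic (n : nat) : Type :=
| AEq of term n & term n
| ARel (r : rsym tau) of ('I_(rarity r) -> term n).

Inductive fo (n : nat) : Type :=
| FAtom of atomic n
| FNot of fo n
| FImp of fo n & fo n
| FAll of fo n.+1.

(* L_{oo,omega}: conjunctions and disjunctions over arbitrary index types *)
Inductive inf_formula (n : nat) : Type :=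
| LAtom of atomic n
| LNot of inf_formula n
| LImp of inf_formula n & inf_formula n
| LAll of inf_formula n.+1
| LConj (J : Type) of (J -> inf_formula n)
| LDisj (J : Type) of (J -> inf_formula n).

Fixpoint of_fo (n : nat) (phi : fo n) : inf_formula n :=
  match phi with
  | FAtom a => LAtom a
  | FNot p => LNot (of_fo p)
  | FImp p q => LImp (of_fo p) (of_fo q)
  | FAll p => LAll (of_fo p)
  end.

(* phi belongs to L_{mu^+,omega}, where mu is the cardinality of B *)
Fixpoint in_L_succ (B : Type) (n : nat) (phi : inf_formula n) : Prop :=
  match phi with
  | LAtom _ => True
  | LNot p => in_L_succ B p
  | LImp p q => in_L_succ B p /\ in_L_succ B q
  | LAll p => in_L_succ B p
  | LConj J F => card_le_type J B /\ forall j, in_L_succ B (F j)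
  | LDisj J F => card_le_type J B /\ forall j, in_L_succ B (F j)
  end.

Definition LAnd n (p q : inf_formula n) : inf_formula n :=
  LConj (fun b : bool => if b then p else q).
Definition LIff n (p q : inf_formula n) : inf_formula n :=
  LAnd (LImp p q) (LImp q p).

Section Satisfaction.
Variable M : structure tau.

(* the bound variable becomes variable 0, the others are shifted by one *)
Definition extend (n : nat) (v : 'I_n -> M) (a : M) : 'I_n.+1 -> M :=
  fun i => if unlift ord0 i is Some j then v j else a.

(* t is defined and has value a: the functions being partial, a term denotes
   only if all its subterms do *)
Fixpoint denotes (n : nat) (v : 'I_n -> M) (t : term n) (a : M) : Prop :=
  match t with
  | Var i => v i = a
  | App f ts => exists x : 'I_(farity f) -> M,
      (forall i, denotes v (ts i) (x i)) /\ funI x = Some a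
  end.

(* an atomic formula containing an undefined term is false *)
Definition sat_atomic (n : nat) (v : 'I_n -> M) (p : atomic n) : Prop :=
  match p with
  | AEq t u => exists a : M, denotes v t a /\ denotes v u a
  | ARel r ts => exists x : 'I_(rarity r) -> M,
      (forall i, denotes v (ts i) (x i)) /\ relI x
  end.

Fixpoint sat (n : nat) (v : 'I_n -> M) (phi : inf_formula n) : Prop :=
  match phi with
  | LAtom a => sat_atomic v a
  | LNot p => ~ sat v p
  | LImp p q => sat v p -> sat v q
  | LAll p => forall a : M, sat (extend v a) p
  | LConj J F => forall j : J, sat v (F j)
  | LDisj J F => exists j : J, sat v (F j)
  end.

End Satisfaction.

Definition models (M : structure tau) (phi : inf_formula 0) : Prop :=
  forall v : 'I_0 -> M, sat v phi.

Definition categorical (phi : inf_formula 0) (kappa : Type) : Prop :=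
  exists M : structure tau,
    [/\ models M phi,
        card_eq_type M kappa
      & forall N : structure tau,
          models N phi -> card_eq_type N kappa -> isomorphic M N].

Definition fo_theory (M : structure tau) : Type :=
  {phi : fo 0 | models M (of_fo phi)}.

End Logic.

Section BasicObjects.
Variable lambda : Type.

Definition finsubset : Type := {A : set lambda | finite_set A}.

Definition frakD : set (set finsubset) :=
  [set A | exists uA : finsubset,
     forall v : finsubset, sval uA `<=` sval v -> A v].

Definition inG (f : finsubset -> 'Z_2) : Prop := frakD [set u | f u = 0%R].

Definition G : Type := {f : finsubset -> 'Z_2 | inG f}.

Lemma inG_add (f g : G) : inG (fun u => sval f u + sval g u)%R.
Proof.
case: f g => [f [u fu]] [g [v gv]].
have uv_fin : finite_set (sval u `|` sval v).
  by rewrite finite_setU; split; apply: svalP.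
exists (exist _ _ uv_fin) => w /= uvw.
by rewrite fu ?gv ?addr0 // => x ?; apply: uvw; [right|left].
Qed.

Definition addG (f g : G) : G :=
  exist _ (fun u => sval f u + sval g u)%R (inG_add f g).

End BasicObjects.

(* [I]^k *)
Definition inj_tuple (I : Type) (k : nat) : Type :=
  {a : 'I_k -> I | injective a}.

Lemma omit_inj (I : Type) (k : nat) (a : inj_tuple I k.+1) (l : 'I_k.+1) :
  injective (fun m : 'I_k => sval a (lift l m)).
Proof. by case: a => a inj_a m n /inj_a /lift_inj. Qed.

(* the tuple <a_m : m <> l> *)
Definition omit (I : Type) (k : nat) (a : inj_tuple I k.+1) (l : 'I_k.+1) :
  inj_tuple I k := exist _ _ (@omit_inj I k a l).

Definition fin_supp (X : Type) (h : X -> 'Z_2) : Prop :=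
  finite_set [set u | h u <> 0%R].

(* H_I *)
Definition H (I : Type) (k : nat) : Type :=
  {h : inj_tuple I k -> 'Z_2 | fin_supp h}.

Lemma fin_supp_add (I : Type) (k : nat) (h h' : H I k) :
  fin_supp (fun u => sval h u + sval h' u)%R.
Proof.
case: h h' => [h fh] [h' fh'].
apply: (@sub_finite_set _ _ ([set u | h u <> 0%R] `|` [set u | h' u <> 0%R])).
  move=> u /= hu; case: (pselect (h u = 0%R)) => [h0|]; [right=> h'0|by left].
  by apply: hu; rewrite h0 h'0 addr0.
by rewrite finite_setU.
Qed.

Definition addH (I : Type) (k : nat) (h h' : H I k) : H I k :=
  exist _ (fun u => sval h u + sval h' u)%R (fin_supp_add h h').

Section Structure.
Variables (lambda : Type) (k : nat).
Local Notation S := (finsubset lambda).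
Local Notation G := (G lambda).

Inductive tau_fun : Type :=
| Fpi0 of 'I_k
| Fpi1 of 'I_k.+1
| F2 | F3 | F4 | F5
| F3g of G.

Inductive tau_rel : Type :=
| P0 | P11 | P12
| P2 | P2s of S
| P3 | P3s of S
| P4 | P5
| Q of S.

Definition tau_farity (f : tau_fun) : nat := if f is F4 then 2 else 1.

Definition tau_rarity (r : tau_rel) : nat := if r is Q _ then (3 * k).+4 else 1.

Definition tau : vocabulary := Vocabulary tau_farity tau_rarity.

Section Over.
Variable I : Type.

Inductive univ : Type :=
| U0 of I
| U11 of inj_tuple I k
| U12 of inj_tuple I k.+1
| U2 of inj_tuple I k & S & H I k
| U3 of inj_tuple I k & S & 'Z_2
| U4 of H I k
| U5 of inj_tuple I k.+1 & G.

Definition M_fun (f : tau_fun) : ('I_(tau_farity f) -> univ) -> option univ :=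
  match f return ('I_(tau_farity f) -> univ) -> option univ with
  | Fpi0 l => fun x => if x ord0 is U11 u then Some (U0 (sval u l)) else None
  | Fpi1 l => fun x => if x ord0 is U12 u then Some (U0 (sval u l)) else None
  | F2 => fun x => if x ord0 is U2 u _ _ then Some (U11 u) else None
  | F3 => fun x => if x ord0 is U3 u _ _ then Some (U11 u) else None
  | F4 => fun x =>
      match x ord0, x ord_max with
      | U2 v s h, U4 h1 => Some (U2 v s (addH h h1))
      | _, _ => None
      end
  | F5 => fun x => if x ord0 is U5 u _ then Some (U12 u) else None
  | F3g gs => fun x => if x ord0 is U5 u g then Some (U5 u (addG gs g)) else None
  end.

(* the tuple x lists a_0..a_k, u_0..u_k, x_0..x_{k-1}, y_k, z in this order *)
Definition Q_holds (s : S) (x : 'I_(3 * k).+4 -> univ) : Prop :=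
  exists (a : inj_tuple I k.+1) (i : 'I_k -> 'Z_2) (h : H I k) (g : G),
    [/\ forall l : 'I_k.+1, x (inord l) = U0 (sval a l),
        forall l : 'I_k.+1, x (inord (k.+1 + l)) = U11 (omit a l),
        forall l : 'I_k, x (inord (2 * k.+1 + l)) =
          U3 (omit a (widen_ord (leqnSn k) l)) s (i l),
        x (inord (3 * k + 2)) = U2 (omit a ord_max) s h /\
          x (inord (3 * k + 3)) = U5 a g
      & (\sum_(l < k) i l = sval h (omit a ord0) + sval g s)%R].

Definition M_rel (r : tau_rel) : ('I_(tau_rarity r) -> univ) -> Prop :=
  match r return ('I_(tau_rarity r) -> univ) -> Prop with
  | P0 => fun x => exists i, x ord0 = U0 i
  | P11 => fun x => exists u, x ord0 = U11 u
  | P12 => fun x => exists u, x ord0 = U12 u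
  | P2 => fun x => exists u s h, x ord0 = U2 u s h
  | P2s s => fun x => exists u h, x ord0 = U2 u s h
  | P3 => fun x => exists u s i, x ord0 = U3 u s i
  | P3s s => fun x => exists u i, x ord0 = U3 u s i
  | P4 => fun x => exists h, x ord0 = U4 h
  | P5 => fun x => exists u g, x ord0 = U5 u g
  | Q s => fun x => Q_holds s x
  end.

Definition M : structure tau := @Structure tau univ M_fun M_rel.

End Over.

Definition var n (i : 'I_n) : term tau n := Var tau i.

(* the application of a unary function symbol, resp. predicate *)
Definition app1 n (f : fsym tau) (t : term tau n) : term tau n :=
  App (f := f) (fun _ => t).
Definition rel1 n (r : rsym tau) (t : term tau n) : inf_formula tau n :=
  LAtom (ARel (r := r) (fun _ => t)).
Definition eqn n (t u : term tau n) : inf_formula tau n := LAtom (AEq t u).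

(* In the scope of two quantifiers, the outer variable z_1 has index 1 and the
   inner one z_2 has index 0. *)
Definition psi_F5 : inf_formula tau 0 :=
  let z1 : term tau 2 := var ord_max in
  let z2 : term tau 2 := var ord0 in
  LAll (LAll (LImp
    (LAnd (LAnd (rel1 P5 z1) (rel1 P5 z2)) (eqn (app1 F5 z1) (app1 F5 z2)))
    (LDisj (fun g : G => eqn (app1 (F3g g) z1) z2)))).

Definition psi_P2 : inf_formula tau 0 :=
  let y : term tau 1 := var ord0 in
  LAll (LIff (rel1 P2 y) (LDisj (fun s : S => rel1 (P2s s) y))).

Definition psi_P3 : inf_formula tau 0 :=
  let y : term tau 1 := var ord0 in
  LAll (LIff (rel1 P3 y) (LDisj (fun s : S => rel1 (P3s s) y))).

(* psi_k^lambda, where T_0 is taken to be the complete theory of the structure M_I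
   for the given (infinite) I. *)
Definition psi (I : Type) : inf_formula tau 0 :=
  LAnd (LConj (fun phi : fo_theory (M I) => of_fo (sval phi)))
       (LAnd psi_F5 (LAnd psi_P2 psi_P3)).

End Structure.

Lemma sig_eq (T : Type) (P : T -> Prop) (u v : {x | P x}) :
  sval u = sval v -> u = v.
Proof. by case: u v => [u pu] [v pv] /= uv; exact: eq_exist. Qed.

Lemma card_le_typeP (A B : Type) :
  card_le_type A B <-> exists f : A -> B, injective f.
Proof.
split=> [/card_leP[f]|[f finj]].
  exists (fun a => set_val (f (SigSub (in_setT a)))) => a b /val_inj.
  by move/(@inj _ _ _ f) => /(_ (in_setT _) (in_setT _)) /(congr1 set_val).
have /injfunPex[g] : exists2 g : A -> B, set_fun setT setT g & set_inj setT g.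
  by exists f => // a b _ _ /finj.
exact: inj_card_le.
Qed.

Lemma card_min_exists (J : Type) (A : J -> Type) (j0 : J) :
  exists j, forall i, exists f : A j -> A i, injective f.
Proof.
pose P : set (set (forall i, A i)) :=
  [set S | forall i s t, S s -> S t -> s i = t i -> s = t].
have [F FP Ftot|S [SP Smax]] := @Zorn_bigcup _ P.
  move=> i s t [X FX Xs] [Y FY Yt].
  by have [XY|YX] := Ftot _ _ FX FY; [apply: (FP _ FY)|apply: (FP _ FX)];
    try exact: XY; try exact: YX.
have [j jsurj] : exists j, forall a, exists s, S s /\ s j = a.
  apply: contrapT => /forallNP nsurj.
  have nsurj' j : {a | forall s, S s -> s j <> a}.
    apply: cid; have /existsNP[a /forallNP na] := nsurj j.
    by exists a => s Ss sa; apply: (na s).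
  pose t j := sval (nsurj' j).
  have St s i : S s -> s i <> t i by move=> Ss; exact: (svalP (nsurj' i)).
  apply: (Smax (S `|` [set t])).
    split=> [s ?|]; first by left.
    by move=> /(_ t (or_intror erefl)) /(St _ j0); apply.
  move=> i s s' [Ss|->] [Ss'|->] //; first exact: SP.
    by move/(St _ _ Ss).
  by move/esym/(St _ _ Ss').
pose g a := sval (cid (jsurj a)).
have gS a : S (g a) by rewrite /g; case: cid => ? [].
have gj a : g a j = a by rewrite /g; case: cid => ? [].
exists j => i; exists (fun a => g a i) => a b /(SP _ _ _ (gS a) (gS b)) gab.
by rewrite -(gj a) -(gj b) gab.
Qed.

Lemma card_total (A B : Type) :
  (exists f : A -> B, injective f) \/ (exists f : B -> A, injective f).
Proof.
have [[] h] := card_min_exists (fun b : bool => if b then A else B) true.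
  by left; exact: h false.
by right; exact: h true.
Qed.

Lemma card_succ_exists (A : Type) : exists B : Type, is_card_succ A B.
Proof.
pose big (B : set (A -> bool)) := ~ exists f : {x | B x} -> A, injective f.
have bigT : big setT.
  case=> f finj; pose d a := `[< exists g, f (exist _ g Logic.I) = a /\ ~~ g a >].
  pose a := f (exist _ d Logic.I).
  have [da|nda] := boolP (d a).
    move/asboolP: (da) => [g [/finj gd]]; move/(congr1 sval): gd => /= ->.
    by rewrite da.
  by case/negP: (nda); apply/asboolP; exists d.
have [[B Bbig] Bmin] :=
  card_min_exists (fun B : {B | big B} => {x | sval B x}) (exist _ setT bigT).
have big_lt C : ~ (exists f : C -> A, injective f) -> card_lt_type A C.
  move=> nCA; split.
    by apply/card_le_typeP; have [//|/nCA] := card_total A C.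
  by rewrite card_le_typeP.
exists {x | B x}; split; first exact: big_lt.
move=> C [_]; rewrite card_le_typeP => nCA; apply/card_le_typeP.
have [[f finj]|[f finj]] := card_total C (A -> bool); last first.
  by exists (fun x => f (sval x)) => -[x ?] [y ?] /finj /= xy; exact: eq_exist.
have cfP (y : {y | range f y}) : {c | f c = sval y}.
  by case: y => y /= fy; apply: cid; case: fy => c _ <-; exists c.
have fbig : big (range f).
  case=> g ginj; apply: nCA.
  exists (fun c => g (exist _ (f c) (ex_intro2 _ _ c Logic.I erefl))).
  by move=> c d /ginj /(congr1 sval) /finj.
have [h hinj] := Bmin (exist _ _ fbig).
exists (fun x => sval (cfP (h x))) => x y /(congr1 f).
by rewrite !(svalP (cfP _)) => /sig_eq /hinj.
Qed.


Definition embeds (A B : Type) := exists f : A -> B, injective f.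

Lemma embeds_trans (A B C : Type) : embeds A B -> embeds B C -> embeds A C.
Proof. by case=> f fi [g gi]; exists (g \o f); exact: inj_comp. Qed.

Lemma embeds_sig (A : Type) (P : A -> Prop) : embeds {x | P x} A.
Proof. by exists sval; exact: sig_eq. Qed.

Lemma embeds_prod (A B A' B' : Type) :
  embeds A A' -> embeds B B' -> embeds (A * B) (A' * B').
Proof.
case=> f fi [g gi]; exists (fun p => (f p.1, g p.2)).
by move=> [a b] [a' b'] [/fi-> /gi->].
Qed.

Lemma embeds_sum (A B A' B' : Type) :
  embeds A A' -> embeds B B' -> embeds (A + B) (A' + B').
Proof.
case=> f fi [g gi]; exists (fun p => match p with inl a => inl (f a) | inr b => inr (g b) end).
by move=> [a|b] [a'|b'] // [] => [/fi->|/gi->].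
Qed.

Lemma embeds_sum_sqr (A B : Type) :
  embeds bool A -> embeds (B * B) B -> embeds A B -> embeds (B + B) B.
Proof.
move=> bA BB AB; apply: embeds_trans BB.
case: (embeds_trans bA AB) => b bi.
exists (fun p => match p with inl x => (b true, x) | inr x => (b false, x) end).
by move=> [x|x] [y|y] [] => [->|/bi|/bi|->].
Qed.

Lemma embeds_nat_bool : embeds bool nat.
Proof. by exists nat_of_bool => -[] []. Qed.

(* Zorn's lemma is applied to the graphs of injections X * X -> X *)
Lemma infinite_sqr (L : Type) : infinite_type L -> embeds (L * L) L.
Proof.
move=> /infiniteP/card_le_typeP[g ginj].
pose X (F : set ((L * L) * L)) x := exists z, F ((x, x), z).
pose good (F : set ((L * L) * L)) :=
  [/\ forall p z z', F (p, z) -> F (p, z') -> z = z',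
      forall p p' z, F (p, z) -> F (p', z) -> p = p',
      forall x y, X F x -> X F y -> exists z, F ((x, y), z)
    & forall x y z, F ((x, y), z) -> [/\ X F x, X F y & X F z]].
pose F0 : set ((L * L) * L) :=
  [set q | exists n m, q = ((g n, g m), g (choice.pickle (n, m)))].
have F0X n : X F0 (g n) by exists (g (choice.pickle (n, n))), n, n.
have F0good : good F0.
  split.
  - by move=> p z z' [n [m [-> ->]]] [n' [m' [/ginj<- /ginj<- ->]]].
  - move=> p p' z [n [m [-> ->]]] [n' [m' [-> /ginj]]].
    by move/(pcan_inj choice.pickleK) => [-> ->].
  - move=> x y [_ [n [_ [-> _ _]]]] [_ [m [_ [-> _ _]]]].
    by exists (g (choice.pickle (n, m))), n, m.
  - by move=> x y z [n [m [-> -> ->]]]; split; exact: F0X.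
pose P : set (set ((L * L) * L)) := [set F | F = set0 \/ good F /\ F0 `<=` F].
have [F FP Ftot|A [AP Amax]] := @Zorn_bigcup _ P.
  have [[F1 FF1 F01]|noF] := pselect (exists2 F1, F F1 & F0 `<=` F1); last first.
    left; rewrite -subset0 => q [Y FY Yq].
    have [Y0|[_ ?]] := FP _ FY; first by rewrite Y0 in Yq.
    by apply: noF; exists Y.
  right; split; last by move=> q /F01 ?; exists F1.
  have Fgood Y q : F Y -> Y q -> good Y.
    by move=> FY Yq; have [Y0|[]//] := FP _ FY; rewrite Y0 in Yq.
  have F2 Y1 Y2 q1 q2 : F Y1 -> F Y2 -> Y1 q1 -> Y2 q2 ->
      exists Y, [/\ F Y, good Y, Y q1 & Y q2].
    move=> FY1 FY2 Yq1 Yq2; have [Y12|Y21] := Ftot _ _ FY1 FY2.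
      by exists Y2; split=> //; [exact: Fgood Yq2|exact: Y12].
    by exists Y1; split=> //; [exact: Fgood Yq1|exact: Y21].
  split.
  - move=> p z z' [Y1 FY1 h1] [Y2 FY2 h2].
    have [Y [FY [Yf _ _ _] k1 k2]] := F2 _ _ _ _ FY1 FY2 h1 h2.
    exact: Yf k1 k2.
  - move=> p p' z [Y1 FY1 h1] [Y2 FY2 h2].
    have [Y [FY [_ Yi _ _] k1 k2]] := F2 _ _ _ _ FY1 FY2 h1 h2.
    exact: Yi k1 k2.
  - move=> x y [zx [Y1 FY1 h1]] [zy [Y2 FY2 h2]].
    have [Y [FY [_ _ Yt _] k1 k2]] := F2 _ _ _ _ FY1 FY2 h1 h2.
    have [|z Yz] := Yt x y _ (ex_intro _ zy k2); first by exists zx.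
    by exists z, Y.
  - move=> x y z [Y FY Yq]; have [_ _ _ Yc] := Fgood _ _ FY Yq.
    by have [[zx ?] [zy ?] [zz ?]] := Yc _ _ _ Yq;
      split; [exists zx, Y|exists zy, Y|exists zz, Y].
have {AP} [[Af Ai At Ac] F0A] : good A /\ F0 `<=` A.
  have [A0|//] := AP; exfalso; apply: (Amax F0); last by right; split.
  rewrite A0; split; first exact: sub0set.
  by move=> /(_ ((g 0, g 0), g (choice.pickle (0, 0)))); apply; exists 0, 0.
pose TX := {x | X A x}; pose TC := {x | ~ X A x}.
have sqrX : embeds (TX * TX) TX.
  have c (p : TX * TX) : {z : L | A ((sval p.1, sval p.2), z)}.
    by apply: cid; apply: At; exact: svalP.
  have cX p : X A (sval (c p)) by have [] := Ac _ _ _ (svalP (c p)).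
  exists (fun p => exist _ _ (cX p)) => p q /(congr1 sval) /= cpq.
  have := svalP (c q); rewrite -cpq => /(Ai _ _ _ (svalP (c p))) [].
  by case: p q {cpq} => [p1 p2] [q1 q2] /= /sig_eq-> /sig_eq->.
have natX : embeds nat TX.
  have gX n : X A (g n) by have [z] := F0X n; exists z; exact: F0A.
  by exists (fun n => exist _ _ (gX n)) => m n /(congr1 sval) /ginj.
have XX : embeds (TX + TX) TX by apply: embeds_sum_sqr natX => //; exact: embeds_nat_bool.
have split_embeds (B : set L) (T : Type) : embeds {x | B x /\ ~ X A x} T ->
    embeds T TX -> embeds {x | X A x \/ B x} TX.
  move=> BT TT; apply: embeds_trans XX.
  apply: (@embeds_trans _ (TX + {x | B x /\ ~ X A x})); last first.
    apply: embeds_sum; first by exists id.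
    exact: embeds_trans TT.
  exists (fun u : {x | X A x \/ B x} =>
    match pselect (X A (sval u)) with
    | left p => inl (exist _ (sval u) p)
    | right p => inr (exist _ (sval u)
        (conj (match svalP u with or_introl q => match p q with end
                                | or_intror q => q end) p))
    end).
  move=> u v; case: pselect => p; case: pselect => q // [] uv; exact: sig_eq.
have [CX|[j jinj]] := card_total TC TX.
  have LX : embeds L TX.
    apply: (@embeds_trans _ {x | X A x \/ setT x}).
      by exists (fun x => exist _ x (or_intror Logic.I)) => x y /(congr1 sval).
    apply: split_embeds CX; exists (fun u => exist _ (sval u) (proj2 (svalP u))).
    by move=> u v /(congr1 sval) /= /sig_eq.
  apply: embeds_trans (embeds_prod LX LX) _.
  by apply: embeds_trans sqrX _; exact: embeds_sig.
exfalso.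
pose Y := [set x | exists u, x = sval (j u)].
have [e einj] : embeds {x | X A x \/ Y x} TX.
  apply: (split_embeds _ TX); last by exists id.
  have c (u : {x | Y x /\ ~ X A x}) : {t | sval u = sval (j t)}.
    by apply: cid; have [] := svalP u.
  exists (fun u => sval (c u)) => u v cuv; apply: sig_eq.
  by rewrite (svalP (c u)) (svalP (c v)) cuv.
case: sqrX => s sinj.
pose new : set ((L * L) * L) := [set q | exists x y : {x | X A x \/ Y x},
  [/\ q.1 = (sval x, sval y), ~ (X A (sval x) /\ X A (sval y))
    & q.2 = sval (j (s (e x, e y)))]].
pose B := A `|` new.
have AX x y z : A ((x, y), z) -> X A x /\ X A y by move/Ac=> [].
have XB x : X B x <-> X A x \/ Y x.
  split=> [[z [Axz|[x' [y' [[-> _] _ _]]]]]|[[z Az]|Yx]].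
  - by left; exists z.
  - by case: x' => /=.
  - by exists z; left.
  - have [Xx|nXx] := pselect (X A x); first by case: Xx => z ?; exists z; left.
    pose x' : {x | X A x \/ Y x} := exist _ x (or_intror Yx).
    by exists (sval (j (s (e x', e x')))); right; exists x', x'; split=> //= -[].
have jN u : ~ X A (sval (j u)) by case: (j u).
apply: (Amax B); last first.
  right; split; last by move=> q /F0A; left.
  split.
  - move=> [x y] z z' [h|[x1 [y1 [/= [hx hy] n1 ->]]]] [h'|[x2 [y2 [/= [hx' hy'] n2 ->]]]].
    + exact: Af h h'.
    + by exfalso; apply: n2; rewrite -hx' -hy'; exact: AX h.
    + by exfalso; apply: n1; rewrite -hx -hy; exact: AX h'.
    + have -> : x1 = x2 by apply: sig_eq; rewrite -hx.
      by have -> : y1 = y2 by apply: sig_eq; rewrite -hy.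
  - move=> [x y] [x' y'] z [h|[x1 [y1 [/= -> n1 hz]]]] [h'|[x2 [y2 [/= -> n2 hz']]]].
    + exact: Ai h h'.
    + by have [_ _] := Ac _ _ _ h; rewrite hz' => /jN.
    + by have [_ _] := Ac _ _ _ h'; rewrite hz => /jN.
    + by move: hz'; rewrite hz => /sig_eq/jinj/sinj[/einj-> /einj->].
  - move=> x y /XB hx /XB hy.
    have [[Xx Xy]|n] := pselect (X A x /\ X A y).
      by have [z ?] := At _ _ Xx Xy; exists z; left.
    pose x' : {x | X A x \/ Y x} := exist _ x hx.
    pose y' : {x | X A x \/ Y x} := exist _ y hy.
    by exists (sval (j (s (e x', e y')))); right; exists x', y'.
  - move=> x y z [/Ac[hx hy hz]|[x1 [y1 [/= [-> ->] _ ->]]]].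
      by split; apply/XB; left.
    by split; apply/XB; [case: x1 => //|case: y1 => //|right; eexists].
split; first by move=> q; left.
have [n _] := natX.
pose u := j (n 0).
have Yu : Y (sval u) by exists (n 0).
have /XB[z Bz] : X A (sval u) \/ Y (sval u) by right.
by move=> /(_ _ Bz) h; apply: (jN (n 0)); exists z.
Qed.

Lemma embeds_arrow (X Y : Type) : embeds X Y -> embeds (X -> bool) (Y -> bool).
Proof.
case=> f finj; exists (fun s y => `[< exists2 x, f x = y & s x >]) => s t.
have E (r : X -> bool) x : `[< exists2 x', f x' = f x & r x' >] = r x.
  by apply/asboolP/idP => [[x' /finj->]|]; last by exists x.
by move=> st; apply/funext => x; rewrite -(E s) -(E t) (congr1 (@^~ (f x)) st).
Qed.

Section Infinite.
Variables (L : Type) (Linf : infinite_type L).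

Let natL : embeds nat L.
Proof. by apply/card_le_typeP/infiniteP. Qed.

Let natsqrL : embeds (nat * L) L.
Proof.
apply: embeds_trans (infinite_sqr Linf).
by apply: embeds_prod => //; exists id.
Qed.

Let sumL : embeds (L + L) L.
Proof.
apply: embeds_sum_sqr natL => //; first exact: embeds_nat_bool.
exact: infinite_sqr.
Qed.

Lemma infinite_seq : embeds (seq L) L.
Proof.
have [g _] := natL; have [c cinj] := infinite_sqr Linf.
apply: embeds_trans natsqrL.
pose e s := foldr (fun x y => c (x, y)) (g 0) s.
exists (fun s => (size s, e s)).
elim=> [|x s IH] [|y t] //= [sz /cinj[-> est]].
by congr cons; apply: IH; rewrite sz est.
Qed.

Lemma card_finsubset : embeds (finsubset L) L.
Proof.
apply: embeds_trans infinite_seq.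
have c (A : finsubset L) : {s : seq {classic L} | sval A = [set` s]}.
  by apply: cid; case: A => A /= /(@finite_seqP {classic L}).
exists (fun A => sval (c A)) => A B cAB; apply: sig_eq.
by rewrite (svalP (c A)) (svalP (c B)) cAB.
Qed.

Lemma card_G : embeds (G L) (L -> bool).
Proof.
apply: embeds_trans (embeds_arrow card_finsubset).
exists (fun f u => sval f u == ord0) => f g /funeqP fg.
apply: sig_eq; apply/funext => u; have := fg u.
by case: (sval f u) (sval g u) => [[|[|//]] p] [[|[|//]] q] // _; exact: val_inj.
Qed.

Let LB : embeds L (L -> bool).
Proof.
exists (fun x y => `[< x = y >]) => x y /(congr1 (@^~ y)) /=.
by rewrite (asboolT erefl) => /asboolP.
Qed.

Let sumB (X Y : Type) :
  embeds X (L -> bool) -> embeds Y (L -> bool) -> embeds (X + Y) (L -> bool).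
Proof.
move=> [f fi] [g gi]; apply: (@embeds_trans _ (L + L + unit -> bool)); last first.
  apply: embeds_arrow; apply: embeds_trans sumL.
  apply: embeds_sum sumL _; case: natL => h _; exists (fun=> h 0) => -[] [] //.
exists (fun u z => match u, z with
  | inl x, inl (inl l) => f x l
  | inr y, inl (inr l) => g y l
  | inl _, inr _ => true
  | _, _ => false end).
move=> [x|y] [x'|y'] /funeqP e.
- by congr inl; apply: fi; apply/funext=> l; exact: e (inl (inl l)).
- by have := e (inr tt).
- by have := e (inr tt).
- by congr inr; apply: gi; apply/funext=> l; exact: e (inl (inr l)).
Qed.

Lemma seqB (X : Type) : embeds X (L -> bool) -> embeds (seq X) (L -> bool).
Proof.
case=> f fi; apply: (@embeds_trans _ (nat + nat * L -> bool)); last first.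
  by apply: embeds_arrow; apply: embeds_trans (embeds_sum natL natsqrL) sumL.
exists (fun s z => match z with
  | inl n => n < size s
  | inr p => nth (fun=> false) [seq f x | x <- s] p.1 p.2 end) => s t /funeqP st.
apply: (inj_map fi); apply: (@eq_from_nth _ (fun=> false)).
  rewrite !size_map.
  have sz n : (n < size s) = (n < size t) := st (inl n).
  have := sz (size s); have := sz (size t).
  by rewrite !ltnn; case: ltngtP.
by move=> n _; apply/funext => l; exact: st (inr (n, l)).
Qed.

Section Encoding.
Variable k : nat.
Local Notation T := (GenTree.tree (finsubset L + G L)).
Local Notation N := (@GenTree.Node (finsubset L + G L)).
Local Notation nat_tree n := (N n [::]).

Definition enc_fun (f : tau_fun L k) : T :=
  match f with
  | Fpi0 l => N 0 [:: nat_tree l]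
  | Fpi1 l => N 1 [:: nat_tree l]
  | F2 => N 2 [::] | F3 => N 3 [::] | F4 => N 4 [::] | F5 => N 5 [::]
  | F3g g => N 6 [:: GenTree.Leaf (inr g)]
  end.

Lemma enc_fun_inj : injective enc_fun.
Proof.
by move=> [l|l|||||g] [l'|l'|||||g'] //= [] => [/val_inj->|/val_inj->|->].
Qed.

Definition enc_rel (r : tau_rel L) : T :=
  match r with
  | P0 => N 0 [::] | P11 => N 1 [::] | P12 => N 2 [::]
  | P2 => N 3 [::] | P2s s => N 4 [:: GenTree.Leaf (inl s)]
  | P3 => N 5 [::] | P3s s => N 6 [:: GenTree.Leaf (inl s)]
  | P4 => N 7 [::] | P5 => N 8 [::] | Q s => N 9 [:: GenTree.Leaf (inl s)]
  end.

Lemma enc_rel_inj : injective enc_rel.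
Proof. by case=> [||||?||?|||?] [||||?||?|||?] //= [->]. Qed.

Fixpoint enc_term n (t : term (tau L k) n) : T :=
  match t with
  | Var i => N 0 [:: nat_tree i]
  | App f ts => N 1 (enc_fun f :: [seq enc_term (ts i) | i <- enum 'I_(farity f)])
  end.

Lemma enc_term_inj n : injective (@enc_term n).
Proof.
elim=> [i|f ts IH] [i'|f' ts'] //=; first by case=> /val_inj->.
case=> /enc_fun_inj ff'; subst f' => /eq_in_map ets; congr App.
by apply/funext => i; apply: IH; apply: ets; rewrite mem_enum.
Qed.

Definition enc_atomic n (a : atomic (tau L k) n) : T :=
  match a with
  | AEq t u => N 0 [:: enc_term t; enc_term u]
  | ARel r ts => N 1 (enc_rel r :: [seq enc_term (ts i) | i <- enum 'I_(rarity r)])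
  end.

Lemma enc_atomic_inj n : injective (@enc_atomic n).
Proof.
move=> [t u|r ts] [t' u'|r' ts'] //=.
  by case=> /enc_term_inj-> /enc_term_inj->.
case=> /enc_rel_inj rr'; subst r' => /eq_in_map ets; congr ARel.
by apply/funext => i; apply: enc_term_inj; apply: ets; rewrite mem_enum.
Qed.

Fixpoint enc_fo n (p : fo (tau L k) n) : T :=
  match p with
  | FAtom a => N 0 [:: enc_atomic a]
  | FNot p => N 1 [:: enc_fo p]
  | FImp p q => N 2 [:: enc_fo p; enc_fo q]
  | FAll p => N 3 [:: enc_fo p]
  end.

Lemma enc_fo_inj n : injective (@enc_fo n).
Proof.
move=> p; elim: p => {n} [n a|n p IH|n p IHp q IHq|n p IH] [a'|p'|p' q'|p'] //=.
- by case=> /enc_atomic_inj->.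
- by case=> /IH->.
- by case=> /IHp-> /IHq->.
- by case=> /IH->.
Qed.

Lemma card_fo n : embeds (fo (tau L k) n) (L -> bool).
Proof.
apply: (@embeds_trans _ T); first by exists (@enc_fo n); exact: enc_fo_inj.
apply: (@embeds_trans _ (seq (nat + (finsubset L + G L)))).
  by exists (@GenTree.encode _); exact: pcan_inj (@GenTree.codeK _).
apply: seqB; apply: sumB; first exact: embeds_trans natL LB.
by apply: sumB; [apply: embeds_trans card_finsubset LB|exact: card_G].
Qed.

Lemma psi_in_L (I : Type) : in_L_succ (beth 1 L) (psi L k I).
Proof.
have bB : card_le_type bool (beth 1 L).
  apply/card_le_typeP; apply: embeds_trans embeds_nat_bool _.
  exact: embeds_trans natL LB.
have SB : card_le_type (finsubset L) (beth 1 L).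
  by apply/card_le_typeP; exact: embeds_trans card_finsubset LB.
have GB : card_le_type (G L) (beth 1 L) by apply/card_le_typeP; exact: card_G.
have TB : card_le_type (fo_theory (M L k I)) (beth 1 L).
  by apply/card_le_typeP; apply: embeds_trans (card_fo 0); exact: embeds_sig.
have fo_in n (p : fo (tau L k) n) : in_L_succ (beth 1 L) (of_fo p).
  by elim: p.
by repeat (split=> //=; try case) => //= *; repeat (split=> //=; try case).
Qed.

End Encoding.
End Infinite.

Lemma addGK (L : Type) (g g' : G L) : addG (addG g' g) g = g'.
Proof.
apply: sig_eq; apply/funext => u /=; rewrite -GRing.addrA.
by case: (sval g u) => -[|[|//]] p; rewrite [X in (_ + X)%R](_ : _ = 0%R) ?GRing.addr0 //; apply: val_inj.
Qed.

Lemma M_models_psi (L : Type) (k : nat) (I : Type) : models (M L k I) (psi L k I).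
Proof.
have unary (T : Type) (x : 'I_1 -> T) b : (forall i, b = x i) -> x ord0 = b by move=> /(_ ord0).
move=> v [|[|[|]]].
- by move=> [phi phiT]; exact: phiT.
- move=> z1 z2 /= h.
  have e1 : extend (extend v z1) z2 ord_max = z1.
    rewrite /extend; case: unliftP => [j|//] /(congr1 val) /= j0.
    by case: unliftP => // j' /(congr1 val); case: j j0 => -[].
  have e0 : extend (extend v z1) z2 ord0 = z2.
    by rewrite /extend unlift_none.
  have /= [x [/= hx [u [g xu]]]] := h true true.
  have /= [y [/= hy [u' [g' yu']]]] := h true false.
  have /= [w [[a [ha aw]] [b [hb bw]]]] := h false.
  have z1E : z1 = U5 u g by rewrite -xu -e1; exact: hx.
  have z2E : z2 = U5 u' g' by rewrite -yu' -e0; exact: hy.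
  have uu' : u = u'.
    move: aw bw; rewrite -(ha ord0) -(hb ord0) e0 e1 z1E z2E => -[<-] [] //.
  exists (addG g' g), z2; split=> //.
  exists (fun=> z1); split=> [i //|]; rewrite /= z1E z2E uu'.
  by rewrite addGK.
- move=> y [] /=.
    move=> [x [hx [u [s [h xE]]]]]; exists s, x; split=> //; by exists u, h.
  by move=> [s [x [hx [u [h xE]]]]]; exists x; split=> //; exists u, s, h.
- move=> y [] /=.
    move=> [x [hx [u [s [h xE]]]]]; exists s, x; split=> //; by exists u, h.
  by move=> [s [x [hx [u [h xE]]]]]; exists x; split=> //; exists u, s, h.
Qed.

(* Main.v *)
Require Import Defs.
From mathcomp Require Import all_boot all_algebra.
From mathcomp Require Import boolp classical_sets functions cardinality.
From mathcomp Require Import zify.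

(** For a function c from [J]^(k+1) to Z_2, let the twisted structure be M_J
    with the equation defining each Q_s replaced by
      sum_l i_l = h(u_0) + g(s) + c(a).

    Every twisted structure is a model of psi.  A first order formula mentions
    finitely many of the Q_s, say those with s in S0, and some element of G
    agrees with c(a) on S0; so in the corresponding reduct the twist is absorbed
    by a change of origin in the fibre of P_5 over a.  A back-and-forth argument
    along finite partial bijections between I and J, combined with this change
    of origin, shows that the twisted structure over J has the theory of M_I
    (fo_indistinguishable, twisted_models_psi).  It has the cardinality of J when
    J is infinite and S and G embed in J (card_univ).

    For a suitable c the twisted structure is not isomorphic to M_J when J is
    larger than lambda.  An isomorphism induces a permutation sigma of J and
    changes of origin b, d, e in the fibres of P_3, P_2, P_5 with
      c(a) + sum_(l<k) b(u_l, s) = d(u_k, s)(sigma u_0) + e(a)(s)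
    (gauge_of_iso).  Fix a point p_0 and let c(a) = 1 iff p_0 is not an entry
    of a.  Take an injective tuple p = (p_0, ..., p_k), a further point x, and
    sum the equations for the k+1 tuples obtained from (p, x) by omitting one
    entry of p.  On the left, c contributes 1 and the double sum of b vanishes,
    being a sum over faces of faces.  For s large all the terms e(a)(s) vanish,
    so some d(p minus p_j, s) is nonzero at a tuple with last entry sigma(x);
    by finiteness of supports this leaves finitely many x for each s.
    Since s ranges over the finite subsets of lambda, J embeds in lambda
    (twisted_avoids_not_iso).

    Both M_kappa and its twist are therefore models of psi of cardinality kappa,
    and they are not isomorphic because kappa > lambda. *)

Set Implicit Arguments.
Unset Strict Implicit.
Unset Printing Implicit Defensive.

Import GRing.Theory.
Local Open Scope classical_set_scope.

(** * Twisted structures *)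

Section Twisted.
Variables (lambda : Type) (k : nat) (I : Type) (c : inj_tuple I k.+1 -> 'Z_2).
Local Notation S := (finsubset lambda).

Definition twisted_Q (s : S) (x : 'I_(3 * k).+4 -> univ lambda k I) : Prop :=
  exists (a : inj_tuple I k.+1) (i : 'I_k -> 'Z_2) (h : H I k) (g : G lambda),
    [/\ forall l : 'I_k.+1, x (inord l) = U0 _ _ (sval a l),
        forall l : 'I_k.+1, x (inord (k.+1 + l)) = U11 _ (omit a l),
        forall l : 'I_k, x (inord (2 * k.+1 + l)) =
          U3 (omit a (widen_ord (leqnSn k) l)) s (i l),
        x (inord (3 * k + 2)) = U2 (omit a ord_max) s h /\
          x (inord (3 * k + 3)) = U5 a g
      & (\sum_(l < k) i l = sval h (omit a ord0) + sval g s + c a)%R].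

Definition twisted_rel (r : tau_rel lambda) :
    ('I_(tau_rarity k r) -> univ lambda k I) -> Prop :=
  match r return ('I_(tau_rarity k r) -> univ lambda k I) -> Prop with
  | Q s => fun x => twisted_Q s x
  | r0 => @M_rel lambda k I r0
  end.

Definition twisted : structure (tau lambda k) :=
  @Structure (tau lambda k) (univ lambda k I) (@M_fun lambda k I) twisted_rel.

End Twisted.

Lemma twisted0 lambda k I :
  twisted lambda (fun _ : inj_tuple I k.+1 => 0%R) = M lambda k I.
Proof.
suff -> : M lambda k I =
    @Structure (tau lambda k) _ (@M_fun lambda k I) (twisted_rel (fun=> 0%R)) by [].
apply: (congr1 (@Structure (tau lambda k) _ (@M_fun lambda k I))).
apply: functional_extensionality_dep => -[] // s.
apply/funext => x; apply/propext.
by split=> -[a [i [h [g [? ? ? ? e]]]]]; exists a, i, h, g; split=> //;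
  rewrite e addr0.
Qed.

(** * Partial isomorphisms induced by finite partial bijections *)

Lemma finite_subsingleton (T : Type) (A : set T) :
  (forall x y, A x -> A y -> x = y) -> finite_set A.
Proof.
move=> A1; have [[x Ax]|A0] := pselect (exists x, A x).
  by apply: (sub_finite_set _ (finite_set1 x)) => y Ay; exact: A1.
by apply: (sub_finite_set _ (@finite_set0 T)) => y Ay; apply: A0; exists y.
Qed.

Lemma finite_rel_image (T U : Type) (R : T -> U -> Prop) (A : set T) :
  (forall x y z, R x y -> R x z -> y = z) -> finite_set A ->
  finite_set [set y | exists2 x, A x & R x y].
Proof.
move=> Rf Afin.
apply: (@sub_finite_set _ _ (\bigcup_(x in A) [set y | R x y])).
  by move=> y [x Ax Rxy]; exists x.
apply: bigcup_finite => // x _; apply: finite_subsingleton => y z; exact: Rf.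
Qed.

Section FinitePartialBijections.
Variables (lambda : Type) (k : nat).

Record fin_pbij (I J : Type) (p : I -> J -> Prop) : Prop := FinPbij {
  pbij_fun : forall i j j', p i j -> p i j' -> j = j';
  pbij_inj : forall i i' j, p i j -> p i' j -> i = i';
  pbij_dom : finite_set [set i | exists j, p i j];
  pbij_ran : finite_set [set j | exists i, p i j]
}.

Definition rel_tuple (I J : Type) (p : I -> J -> Prop) (n : nat)
    (u : inj_tuple I n) (v : inj_tuple J n) : Prop :=
  forall m, p (sval u m) (sval v m).

(** The transport of a finitely supported function along p, which exists only
    when all the tuples in the support are covered by p; stated symmetrically. *)
Record rel_H (I J : Type) (p : I -> J -> Prop) (h : H I k) (h' : H J k) : Prop :=
  RelH {
  rel_H_eq : forall u v, rel_tuple p u v -> sval h u = sval h' v;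
  rel_H_suppl : forall u, sval h u <> 0%R -> exists v, rel_tuple p u v;
  rel_H_suppr : forall v, sval h' v <> 0%R -> exists u, rel_tuple p u v
}.

(** The part of the twist that formulas mentioning only the Q_s with s in S0
    can see. *)
Definition twist_on (I : Type) (S0 : set (finsubset lambda))
    (c : inj_tuple I k.+1 -> 'Z_2) (a : inj_tuple I k.+1) (s : finsubset lambda) : 'Z_2 :=
  if `[< S0 s >] then c a else 0%R.

(** The partial isomorphism over p.  On P_5 it preserves g + c(a) at the points
    of S0 and g elsewhere: the first makes Q_s invariant for s in S0, and both
    together let g and g' differ on S0 only, hence by an element of G when S0 is
    finite. *)
Definition rel_univ (S0 : set (finsubset lambda)) (I J : Type)
    (c : inj_tuple I k.+1 -> 'Z_2) (c' : inj_tuple J k.+1 -> 'Z_2)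
    (p : I -> J -> Prop) (x : univ lambda k I) (y : univ lambda k J) : Prop :=
  match x, y with
  | U0 i, U0 j => p i j
  | U11 u, U11 v => rel_tuple p u v
  | U12 a, U12 b => rel_tuple p a b
  | U2 u s h, U2 v s' h' => [/\ rel_tuple p u v, s = s' & rel_H p h h']
  | U3 u s i, U3 v s' i' => [/\ rel_tuple p u v, s = s' & i = i']
  | U4 h, U4 h' => rel_H p h h'
  | U5 a g, U5 b g' => rel_tuple p a b /\ forall s,
      (sval g s + twist_on S0 c a s = sval g' s + twist_on S0 c' b s)%R
  | _, _ => False
  end.

Lemma fin_pbij_flip I J (p : I -> J -> Prop) :
  fin_pbij p -> fin_pbij (fun j i => p i j).
Proof. by case=> pf pi pd pr; split=> // i j j'; [apply: pi|apply: pf]. Qed.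

Lemma rel_H_flip I J (p : I -> J -> Prop) h h' :
  rel_H p h h' -> rel_H (fun j i => p i j) h' h.
Proof. by case=> he hl hr; split=> [u v /he|u /hr|v /hl]. Qed.

Lemma rel_univ_flip S0 I J (c : inj_tuple I k.+1 -> 'Z_2)
    (c' : inj_tuple J k.+1 -> 'Z_2) p x y :
  rel_univ S0 c c' p x y -> rel_univ S0 c' c (fun j i => p i j) y x.
Proof.
case: x y => [i|u|a|u s h|u s i|h|a g] [j|v|b|v s' h'|v s' i'|h'|b g'] //=.
- by case=> ? -> /rel_H_flip.
- by case=> ? -> ->.
- exact: rel_H_flip.
- by case=> ? e; split=> // s; rewrite e.
Qed.

Section Preservation.
Variables (S0 : set (finsubset lambda)) (I J : Type).
Variables (c : inj_tuple I k.+1 -> 'Z_2) (c' : inj_tuple J k.+1 -> 'Z_2).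
Variables (p : I -> J -> Prop) (pP : fin_pbij p).
Local Notation R := (rel_univ S0 c c' p).

Lemma rel_tuple_fun n (u : inj_tuple I n) (v w : inj_tuple J n) :
  rel_tuple p u v -> rel_tuple p u w -> v = w.
Proof.
by move=> uv uw; apply: sig_eq; apply/funext => m; apply: (pbij_fun pP (uv m)).
Qed.

Lemma rel_tuple_inj n (u v : inj_tuple I n) (w : inj_tuple J n) :
  rel_tuple p u w -> rel_tuple p v w -> u = v.
Proof.
by move=> uw vw; apply: sig_eq; apply/funext => m; apply: (pbij_inj pP (uw m)).
Qed.

Lemma rel_tuple_omit n (u : inj_tuple I n.+1) (v : inj_tuple J n.+1) l :
  rel_tuple p u v -> rel_tuple p (omit u l) (omit v l).
Proof. by move=> uv m; exact: uv. Qed.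

Lemma rel_H_fun h h1 h2 : rel_H p h h1 -> rel_H p h h2 -> h1 = h2.
Proof.
move=> [e1 l1 r1] [e2 l2 r2]; apply: sig_eq; apply/funext => v.
have [[u uv]|nu] := pselect (exists u, rel_tuple p u v).
  by rewrite -(e1 _ _ uv) (e2 _ _ uv).
by have [] := (contra_notP (@r1 v) nu, contra_notP (@r2 v) nu) => -> ->.
Qed.

Lemma rel_univ_fun x y z : R x y -> R x z -> y = z.
Proof.
case: x y z => [i|u|a|u s h|u s i|h|a g] [j|v|b|v s' h'|v s' i'|h'|b g']
  [j2|v2|b2|v2 s2 h2|v2 s2 i2|h2|b2 g2] //=.
- by move=> /(pbij_fun pP) e /e ->.
- by move=> /rel_tuple_fun e /e ->.
- by move=> /rel_tuple_fun e /e ->.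
- by move=> [/rel_tuple_fun e <- /rel_H_fun f] [/e -> <- /f ->].
- by move=> [/rel_tuple_fun e <- <-] [/e -> <- <-].
- by move=> /rel_H_fun f /f ->.
- move=> [/rel_tuple_fun e f] [/e bb f2]; rewrite -bb in f2 *; congr U5.
  by apply: sig_eq; apply/funext => s; apply: (addIr (twist_on S0 c' b s));
    rewrite -f f2.
Qed.

Lemma rel_H_add h1 h1' h2 h2' :
  rel_H p h1 h1' -> rel_H p h2 h2' -> rel_H p (addH h1 h2) (addH h1' h2').
Proof.
move=> [e1 l1 r1] [e2 l2 r2]; split=> [u v uv|u|v] /=.
- by rewrite (e1 _ _ uv) (e2 _ _ uv).
- case: (pselect (sval h1 u = 0%R)) => [->|/l1//]; rewrite add0r; exact: l2.
- case: (pselect (sval h1' v = 0%R)) => [->|/r1//]; rewrite add0r; exact: r2.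
Qed.

(** The translations F_{3,g*} act on both sides by the same g*, so they commute
    with the change of origin of the P_5 fibres. *)
Lemma rel_univ_funI (f : Defs.fsym (tau lambda k)) (x : 'I_(farity f) -> univ lambda k I)
    (y : 'I_(farity f) -> univ lambda k J) a :
  (forall i, R (x i) (y i)) -> M_fun x = Some a ->
  exists2 b, M_fun y = Some b & R a b.
Proof.
case: f x y => [l|l|||||g] x y xy /=; have := xy ord0; last first.
- case: (x ord0) (y ord0) => // u g1 [] //= v g2 [uv e] [<-]; eexists; first by [].
  by split=> // s; rewrite /= -!addrA e.
- by case: (x ord0) (y ord0) => // u g1 [] //= v g2 [uv e] [<-]; eexists.
- have := xy ord_max.
  case: (x ord0) (x ord_max) (y ord0) (y ord_max) => // u s h [] // h1.
  move=> [] // v s' h' [] //= h1' hh1 [uv <- hh] [<-].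
  by eexists; [by []|split=> //; exact: rel_H_add].
- by case: (x ord0) (y ord0) => // u s i [] //= v s' i' [uv _ _] [<-]; eexists.
- by case: (x ord0) (y ord0) => // u s i [] //= v s' i' [uv _ _] [<-]; eexists.
- by case: (x ord0) (y ord0) => // u [] //= v uv [<-]; eexists; [by []|exact: uv].
- by case: (x ord0) (y ord0) => // u [] //= v uv [<-]; eexists; [by []|exact: uv].
Qed.

(** For s in S0 the quantity g(s) + c(a) in the defining equation is an invariant
    of the relation. *)
Lemma rel_univ_Q s (x : 'I_(3 * k).+4 -> univ lambda k I) y : S0 s ->
  (forall i, R (x i) (y i)) -> twisted_Q c s x -> twisted_Q c' s y.
Proof.
move=> S0s xy [a [i [h [g [ea eu ei [eh eg] e]]]]].
have Rxy n b : x (inord n) = b -> R b (y (inord n)) by move=> <-; exact: xy.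
have [a' [g' [aa' gg' eg']]] : exists a' g', [/\ rel_tuple p a a',
    (sval g s + c a = sval g' s + c' a')%R & y (inord (3 * k + 3)) = U5 a' g'].
  case: (y _) (Rxy _ _ eg) => //= a' g' [aa' /(_ s)].
  by rewrite /twist_on asboolT // => gg'; exists a', g'.
have omit_fun l v : rel_tuple p (omit a l) v -> v = omit a' l.
  by move/rel_tuple_fun; apply; exact: rel_tuple_omit.
have [h' [hh' eh']] : exists h', rel_H p h h' /\
    y (inord (3 * k + 2)) = U2 (omit a' ord_max) s h'.
  by case: (y _) (Rxy _ _ eh) => //= v s' h' [/omit_fun -> <- hh']; exists h'.
exists a', i, h', g'; split=> [l|l|l||].
- by case: (y _) (Rxy _ _ (ea l)) => //= j /(pbij_fun pP (aa' l)) ->.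
- by case: (y _) (Rxy _ _ (eu l)) => //= v /omit_fun ->.
- by case: (y _) (Rxy _ _ (ei l)) => //= v s' i' [/omit_fun -> <- <-].
- by split.
- rewrite e -(rel_H_eq hh' (rel_tuple_omit ord0 aa')) -!addrA; congr (_ + _)%R.
  exact: gg'.
Qed.

Lemma rel_univ_rel (r : Defs.rsym (tau lambda k))
    (x : 'I_(rarity r) -> univ lambda k I) y :
  (if r is Q s then S0 s else True) ->
  (forall i, R (x i) (y i)) -> twisted_rel c x -> twisted_rel c' y.
Proof.
case: r x y => [||||s||s|||s] x y S0s xy; last exact: rel_univ_Q.
all: have Rx b : x ord0 = b -> R b (y ord0) by move=> <-.
all: rewrite /=.
- by move=> [i /Rx]; case: (y _) => //= j _; exists j.
- by move=> [u /Rx]; case: (y _) => //= v _; exists v.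
- by move=> [a /Rx]; case: (y _) => //= b _; exists b.
- by move=> [u [t [h /Rx]]]; case: (y _) => //= v t' h' _; exists v, t', h'.
- by move=> [u [h /Rx]]; case: (y _) => //= v t' h' [_ <- _]; exists v, h'.
- by move=> [u [t [i /Rx]]]; case: (y _) => //= v t' i' _; exists v, t', i'.
- by move=> [u [i /Rx]]; case: (y _) => //= v t' i' [_ <- _]; exists v, i'.
- by move=> [h /Rx]; case: (y _) => //= h' _; exists h'.
- by move=> [a [g /Rx]]; case: (y _) => //= b g' _; exists b, g'.
Qed.

Lemma rel_denotes n (v : 'I_n -> twisted lambda c) (w : 'I_n -> twisted lambda c')
    (t : Defs.term (tau lambda k) n) a :
  (forall i, R (v i) (w i)) -> denotes v t a -> exists2 b, denotes w t b & R a b.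
Proof.
move=> vw; elim: t a => [i|f ts IH] a /=; first by move=> <-; exists (w i).
move=> [x [xts fx]].
have y i : {b | denotes w (ts i) b /\ R (x i) b}.
  by apply: cid; have [b ? ?] := IH i _ (xts i); exists b.
have [i|b fy ab] := rel_univ_funI (y := fun i => sval (y i)) _ fx.
  by case: (y i) => ? [].
by exists b => //; exists (fun i => sval (y i)); split=> // i; case: (y i) => ? [].
Qed.

End Preservation.

Lemma rel_sat_atomic S0 I J c c' (p : I -> J -> Prop) n
    (v : 'I_n -> twisted lambda c) (w : 'I_n -> twisted lambda c')
    (q : atomic (tau lambda k) n) : fin_pbij p ->
  (if q is ARel (Q s) _ then S0 s else True) ->
  (forall i, rel_univ S0 c c' p (v i) (w i)) -> sat_atomic v q -> sat_atomic w q.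
Proof.
move=> pP; case: q => [t u|r ts] S0q vw /=.
  move=> [a [/(rel_denotes vw)[b tb ab] /(rel_denotes vw)[b' tb' ab']]].
  by exists b; rewrite {2}(rel_univ_fun pP ab ab').
move=> [x [xts rx]].
have y i : {b | denotes w (ts i) b /\ rel_univ S0 c c' p (x i) b}.
  by apply: cid; have [b ? ?] := rel_denotes vw (xts i); exists b.
exists (fun i => sval (y i)); split=> [i|]; first by case: (y i) => ? [].
apply: (rel_univ_rel (S0 := S0) pP _ _ rx) => [|i]; last by case: (y i) => ? [].
by case: (r) S0q.
Qed.

(** A function related over p vanishes outside the tuples covered by p, on both
    sides; so the tuples newly covered by q carry the value 0 on both sides. *)
Lemma rel_univ_mono S0 I J c c' (p q : I -> J -> Prop) x y :
  fin_pbij q -> (forall i j, p i j -> q i j) ->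
  rel_univ S0 c c' p x y -> rel_univ S0 c c' q x y.
Proof.
move=> qP pq.
have tm n (u : inj_tuple I n) v : rel_tuple p u v -> rel_tuple q u v.
  by move=> uv m; exact: pq.
have hm h h' : rel_H p h h' -> rel_H q h h'.
  move=> [e l r]; split=> [u v uv|u /l|v /r].
  - have [[v' uv']|nu] := pselect (exists v', rel_tuple p u v').
      by rewrite (e _ _ uv'); congr (sval h' _);
        exact: (rel_tuple_fun qP (tm _ _ _ uv') uv).
    have [[u' uv']|nv] := pselect (exists u', rel_tuple p u' v).
      by rewrite -(e _ _ uv'); congr (sval h _);
        exact: (rel_tuple_inj qP uv (tm _ _ _ uv')).
    by have -> := contra_notP (@l u) nu; have -> := contra_notP (@r v) nv.
  - by case=> w uw; exists w; exact: tm.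
  - by case=> w uw; exists w; exact: tm.
case: x y => [i|u|a|u s h|u s i|h|a g] [j|v|b|v s' h'|v s' i'|h'|b g'] //=; auto.
- by move=> [? ? ?]; split; auto.
- by move=> [? ? ?]; split; auto.
- by move=> [? ?]; split; auto.
Qed.

(** * The back-and-forth argument *)

Lemma extend_pbij1 I J (p : I -> J -> Prop) i : infinite_type J -> fin_pbij p ->
  exists2 q, fin_pbij q &
    (forall i j, p i j -> q i j) /\ exists j, q i j.
Proof.
move=> Jinf pP; have [pi|npi] := pselect (exists j, p i j).
  by exists p.
have [j npj] : exists j, ~ exists i, p i j.
  apply: contrapT => nj; apply: Jinf; apply: sub_finite_set (pbij_ran pP) => j _.
  by apply: contrapT => nij; apply: nj; exists j.
exists (fun i' j' => p i' j' \/ i' = i /\ j' = j); last first.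
  by split; [move=> *; left|exists j; right].
split.
- move=> i1 j1 j2 [p1|[e1 ->]] [p2|[e2 ->]] //; first exact: pbij_fun p2.
    by case: npi; exists j1; rewrite -e2.
  by case: npi; exists j2; rewrite -e1.
- move=> i1 i2 j1 [p1|[-> e1]] [p2|[-> e2]] //; first exact: pbij_inj p2.
    by case: npj; exists i1; rewrite -e2.
  by case: npj; exists i2; rewrite -e1.
- apply: (@sub_finite_set _ _ ([set i | exists j, p i j] `|` [set i])).
    by move=> i' [j' [?|[-> _]]]; [left; exists j'|right].
  by rewrite finite_setU; split; [exact: pbij_dom|exact: finite_set1].
- apply: (@sub_finite_set _ _ ([set j | exists i, p i j] `|` [set j])).
    by move=> j' [i' [?|[_ ->]]]; [left; exists i'|right].
  by rewrite finite_setU; split; [exact: pbij_ran|exact: finite_set1].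
Qed.

Lemma extend_pbij I J (p : I -> J -> Prop) (D : set I) :
  infinite_type J -> fin_pbij p -> finite_set D ->
  exists2 q, fin_pbij q &
    (forall i j, p i j -> q i j) /\ forall i, D i -> exists j, q i j.
Proof.
move=> Jinf pP /(@finite_seqP {classic I})[s ->].
elim: s => [|i s [q qP [pq sq]]]; first by exists p.
have [r rP [qr [j ij]]] := extend_pbij1 i Jinf qP.
exists r => //; split; first by auto.
move=> i'; rewrite /= inE => /predU1P[->|/sq[j' ?]]; first by exists j.
by exists j'; exact: qr.
Qed.

Lemma finite_range_tuple I n (u : inj_tuple I n) : finite_set (range (sval u)).
Proof. exact: finite_image. Qed.

(** The indices that a partial bijection must cover for the element to have an
    image: for h in H_I, the entries of all the tuples where h is nonzero. *)
Definition support I (x : univ lambda k I) : set I :=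
  let supp_H (h : H I k) := \bigcup_(u in [set u | sval h u <> 0%R]) range (sval u) in
  match x with
  | U0 i => [set i]
  | U11 u => range (sval u)
  | U12 a => range (sval a)
  | U2 u _ h => range (sval u) `|` supp_H h
  | U3 u _ _ => range (sval u)
  | U4 h => supp_H h
  | U5 a _ => range (sval a)
  end.

Lemma finite_support I (x : univ lambda k I) : finite_set (support x).
Proof.
have fH (h : H I k) :
    finite_set (\bigcup_(u in [set u | sval h u <> 0%R]) range (sval u)).
  apply: bigcup_finite => [|u _]; [exact: (svalP h)|exact: finite_range_tuple].
case: x => [i|u|a|u s h|u s i|h|a g] /=; try exact: finite_range_tuple.
- exact: finite_set1.
- by rewrite finite_setU; split; [exact: finite_range_tuple|exact: fH].
- exact: fH.
Qed.

Lemma rel_tuple_total I J (p : I -> J -> Prop) n (u : inj_tuple I n) :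
  fin_pbij p -> (forall m, exists j, p (sval u m) j) ->
  exists v, rel_tuple p u v.
Proof.
move=> pP up; have f m : {j | p (sval u m) j} := cid (up m).
have inj_f : injective (fun m => sval (f m)).
  move=> m m' e; apply: (svalP u); apply: (pbij_inj pP (svalP (f m))).
  by rewrite e; exact: svalP.
by exists (exist _ _ inj_f) => m /=; exact: svalP.
Qed.

Lemma rel_H_total I J (p : I -> J -> Prop) (h : H I k) : fin_pbij p ->
  (forall u, sval h u <> 0%R -> exists v, rel_tuple p u v) ->
  exists h', rel_H p h h'.
Proof.
move=> pP hp.
pose f (v : inj_tuple J k) : 'Z_2 := if pselect (exists u, rel_tuple p u v)
  is left e then sval h (sval (cid e)) else 0%R.
have fE u v : rel_tuple p u v -> f v = sval h u.
  rewrite /f => uv; case: pselect => [e|[]]; last by exists u.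
  by case: cid => u' /= u'v; rewrite (rel_tuple_inj pP u'v uv).
have fr v : f v <> 0%R -> exists u, rel_tuple p u v.
  by rewrite /f; case: pselect.
have ffin : fin_supp f.
  have := finite_rel_image (@rel_tuple_fun _ _ _ pP k) (svalP h).
  apply: sub_finite_set => v /= fv; have [u uv] := fr _ fv.
  by exists u => //; rewrite -(fE _ _ uv).
by exists (exist _ f ffin); split=> //= u v /fE.
Qed.

(** A point outside s makes every larger finite set different from s. *)
Lemma frakD_setC (S0 : set (finsubset lambda)) :
  infinite_type lambda -> finite_set S0 -> frakD (~` S0).
Proof.
move=> linf /(@finite_seqP {classic (finsubset lambda)})[l ->].
elim: l => [|s l [w wl]].
  by exists (exist _ set0 (@finite_set0 lambda)) => v _ /=; rewrite inE.
have [x xs] : exists x, ~ sval s x.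
  apply: contrapT => nx; apply: linf; apply: sub_finite_set (svalP s) => x _.
  by apply: contrapT => nsx; apply: nx; exists x.
have fw : finite_set (sval w `|` [set x]).
  by rewrite finite_setU; split; [exact: svalP|exact: finite_set1].
exists (exist _ _ fw) => v /= wxv; rewrite inE => /predU1P[vs|vl].
  by apply: xs; rewrite -vs; apply: wxv; right.
by apply: (wl v) => // y wy; apply: wxv; left.
Qed.

(** The role of the filter: an element of G may be altered at finitely many s. *)
Lemma G_twist (S0 : set (finsubset lambda)) (z : 'Z_2) (g : G lambda) :
  infinite_type lambda -> finite_set S0 ->
  exists g' : G lambda, forall s,
    sval g' s = (sval g s + if `[< S0 s >] then z else 0)%R.
Proof.
move=> linf fS0.
suff gG : inG (fun s => sval g s + if `[< S0 s >] then z else 0)%R.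
  by exists (exist _ _ gG).
have [w wS0] := frakD_setC linf fS0; have [u ug] := svalP g.
have fuw : finite_set (sval u `|` sval w).
  by rewrite finite_setU; split; exact: svalP.
exists (exist _ _ fuw) => v /= uwv.
rewrite asboolF ?addr0; first by apply: ug => x ux; apply: uwv; left.
by apply: wS0 => x wx; apply: uwv; right.
Qed.

Lemma rel_univ_total S0 I J (c : inj_tuple I k.+1 -> 'Z_2)
    (c' : inj_tuple J k.+1 -> 'Z_2) p (x : univ lambda k I) :
  infinite_type lambda -> finite_set S0 -> fin_pbij p ->
  (forall i, support x i -> exists j, p i j) -> exists y, rel_univ S0 c c' p x y.
Proof.
move=> linf fS0 pP.
have tT n (u : inj_tuple I n) :
    (forall i, range (sval u) i -> exists j, p i j) -> exists v, rel_tuple p u v.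
  by move=> up; apply: rel_tuple_total => // m; apply: up; exists m.
have hT (h : H I k) : (forall i,
    (\bigcup_(u in [set u | sval h u <> 0%R]) range (sval u)) i ->
    exists j, p i j) -> exists h', rel_H p h h'.
  move=> hp; apply: rel_H_total => // u hu; apply: tT => i ui; apply: hp.
  by exists u.
case: x => [i|u|a|u s h|u s i|h|a g] /= xp.
- by have [//|j ij] := xp i; exists (U0 _ _ j).
- by have [v uv] := tT _ _ xp; exists (U11 _ v).
- by have [v uv] := tT _ _ xp; exists (U12 _ v).
- have [i ui|v uv] := tT _ u; first by apply: xp; left.
  have [i hi|h' hh'] := hT h; first by apply: xp; right.
  by exists (U2 v s h').
- by have [v uv] := tT _ _ xp; exists (U3 v s i).
- by have [h' hh'] := hT _ xp; exists (U4 _ h').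
(* g' solves g + c(a) = g' + c'(b) on S0 *)
- have [b ab] := tT _ _ xp; have [g' gg'] := G_twist (c a - c' b)%R g linf fS0.
  exists (U5 b g'); split=> // s; rewrite gg' /twist_on.
  by case: ifP => _; rewrite -addrA ?subrK ?addr0.
Qed.

Lemma rel_univ_forth S0 I J (c : inj_tuple I k.+1 -> 'Z_2)
    (c' : inj_tuple J k.+1 -> 'Z_2) p n
    (v : 'I_n -> twisted lambda c) (w : 'I_n -> twisted lambda c')
    (a : twisted lambda c) :
  infinite_type lambda -> infinite_type J -> finite_set S0 -> fin_pbij p ->
  (forall i, rel_univ S0 c c' p (v i) (w i)) ->
  exists q b, fin_pbij q /\
    forall i, rel_univ S0 c c' q (extend v a i) (extend w b i).
Proof.
move=> linf Jinf fS0 pP vw.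
have [q qP [pq aq]] := extend_pbij Jinf pP (finite_support a).
have [b ab] := rel_univ_total c c' linf fS0 qP aq.
exists q, b; split=> // i; rewrite /extend; case: unlift => // j.
exact: rel_univ_mono pq (vw j).
Qed.

(** Both index sets, both twists and the partial bijection vary, so that the
    implication applied to the inverse bijection gives its converse. *)
Definition indistinguishable_over S0 n (phi : fo (tau lambda k) n) : Prop :=
  forall I J (c : inj_tuple I k.+1 -> 'Z_2) (c' : inj_tuple J k.+1 -> 'Z_2) p
    (v : 'I_n -> twisted lambda c) (w : 'I_n -> twisted lambda c'),
  infinite_type I -> infinite_type J -> fin_pbij p ->
  (forall i, rel_univ S0 c c' p (v i) (w i)) ->
  sat v (of_fo phi) -> sat w (of_fo phi).

(** S0 collects the s for which Q_s occurs in phi.  Since the relation itself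
    depends on the set of s considered, the claim is made for every larger finite
    set: this lets the two halves of an implication use a common set. *)
Lemma fo_indistinguishable n (phi : fo (tau lambda k) n) : infinite_type lambda ->
  exists2 S0, finite_set S0 & forall S1, finite_set S1 -> S0 `<=` S1 ->
    indistinguishable_over S1 phi.
Proof.
move=> linf; elim: phi => {n} [n q|n phi [S0 fS0 IH]|
  n phi [S1 fS1 IH1] chi [S2 fS2 IH2]|n phi [S0 fS0 IH]].
- have atomic_ok S0 :
      (if q is ARel (Q s) _ then S0 s else True) -> indistinguishable_over S0 (FAtom q).
    move=> S0q I J c c' p v w Iinf Jinf pP vw; exact: rel_sat_atomic vw.
  case: q atomic_ok => [t u|[||||s||s|||s] ts] atomic_ok;
    try by exists set0 => // S1 _ _; exact: atomic_ok.
  exists [set s] => [|S1 _ sS1]; first exact: finite_set1.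
  by apply: atomic_ok; apply: sS1.
- exists S0 => // S1 fS1 S01 I J c c' p v w Iinf Jinf pP vw /= nv sw; apply: nv.
  apply: (IH _ fS1 S01 _ _ _ _ _ _ _ Jinf Iinf (fin_pbij_flip pP) _ sw) => i.
  exact: rel_univ_flip.
- exists (S1 `|` S2); first by rewrite finite_setU.
  move=> S3 fS3 S123 I J c c' p v w Iinf Jinf pP vw /= svw sw.
  apply: (IH2 _ fS3 _ _ _ _ _ _ _ _ Iinf Jinf pP vw) => [s ?|].
    by apply: S123; right.
  apply: svw; apply: (IH1 _ fS3 _ _ _ _ _ _ _ _ Jinf Iinf (fin_pbij_flip pP) _ sw).
    by move=> s ?; apply: S123; left.
  by move=> i; exact: rel_univ_flip.
- exists S0 => // S1 fS1 S01 I J c c' p v w Iinf Jinf pP vw /= sv b.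
  have wv i : rel_univ S1 c' c (fun j i => p i j) (w i) (v i).
    exact: rel_univ_flip.
  have [q [a [qP ab]]] := rel_univ_forth b linf Iinf fS1 (fin_pbij_flip pP) wv.
  apply: (IH _ fS1 S01 _ _ _ _ _ _ _ Iinf Jinf (fin_pbij_flip qP) _ (sv a)) => i.
  exact: rel_univ_flip.
Qed.

End FinitePartialBijections.

(** The non first order conjuncts do not mention the Q_s, and hold as in M_J. *)
Lemma twisted_models_psi lambda k I J (c : inj_tuple J k.+1 -> 'Z_2) :
  infinite_type lambda -> infinite_type I -> infinite_type J ->
  models (twisted lambda c) (psi lambda k I).
Proof.
move=> linf Iinf Jinf v [|]; last first.
  have hv := @M_models_psi lambda k J v false.
  move=> [|[|]].
  - move=> z1 z2 hz; apply: (hv true z1 z2) => -[[|]|].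
    + exact (hz true true).
    + exact (hz true false).
    + exact (hz false).
  - by move=> y [|]; [exact (hv false true y true)|exact (hv false true y false)].
  - by move=> y [|]; [exact (hv false false y true)|exact (hv false false y false)].
move=> [phi] /=; rewrite -twisted0 => phiT.
have [S0 fS0 /(_ _ fS0 (@subset_refl _ S0))] := fo_indistinguishable phi linf.
have v0 : 'I_0 -> twisted lambda (fun _ : inj_tuple I k.+1 => 0%R) by case.
pose p (i : I) (j : J) := False.
have pP : fin_pbij p.
  split=> //; apply: (sub_finite_set _ (@finite_set0 _)) => x [] //.
move=> /(_ _ _ _ c _ v0 v Iinf Jinf pP); apply; first by case.
exact: phiT.
Qed.

(** * What an isomorphism says about the twist *)

Lemma isomorphic_sym tau (M N : structure tau) : isomorphic M N -> isomorphic N M.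
Proof.
case=> h [[g hK gK] hf hr]; have ghE n (x : 'I_n -> N) : h \o (g \o x) = x.
  by apply/funext => i /=; rewrite gK.
exists g; split; first by exists h.
  by move=> f x; rewrite -[in RHS](ghE _ x) hf; case: (funI _) => //= a; rewrite hK.
by move=> r x; rewrite -[in X in _ <-> X](ghE _ x); split=> /hr.
Qed.

Lemma isomorphic_trans tau (M N P : structure tau) :
  isomorphic M N -> isomorphic N P -> isomorphic M P.
Proof.
case=> h [bh hf hr] [g [bg gf gr]]; exists (g \o h); split.
- exact: bij_comp.
- move=> f x; rewrite -[(g \o h) \o x]/(g \o (h \o x)) gf hf.
  by case: (funI x).
- by move=> r x; rewrite -[(g \o h) \o x]/(g \o (h \o x)) gr hr.
Qed.

Lemma Z2_addxx (x : 'Z_2) : (x + x = 0)%R.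
Proof. by case: x => -[|[|//]] ?; exact: val_inj. Qed.

Lemma Z2_neq (x y : 'Z_2) : x <> y -> x = (1 + y)%R.
Proof.
by case: x y => -[|[|//]] ? [[|[|//]] ?] xy; try (case: xy; exact: val_inj);
  exact: val_inj.
Qed.

Definition zeroH (I : Type) (k : nat) : H I k.
Proof.
exists (fun=> 0%R); apply: (sub_finite_set _ (@finite_set0 _)) => u /=; exact.
Defined.

Definition zeroG (lambda : Type) : G lambda.
Proof. by exists (fun=> 0%R); exists (exist _ set0 (@finite_set0 lambda)). Defined.

Section Gauge.
Variables (lambda : Type) (k : nat) (J : Type).
Local Notation S := (finsubset lambda).
Local Notation univ := (univ lambda k J).

(** The tuple listing, in the order of the arguments of Q_s, the entries
    determined by a, s, the values i, h and g. *)
Definition Q_tuple (a : inj_tuple J k.+1) (s : S) (i : nat -> 'Z_2)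
    (h : H J k) (g : G lambda) (n : 'I_(3 * k).+4) : univ :=
  if n < k.+1 then U0 _ _ (sval a (inord n))
  else if n < 2 * k.+1 then U11 _ (omit a (inord (n - k.+1)))
  else if n < 3 * k + 2 then
    U3 (omit a (inord (n - 2 * k.+1))) s (i (n - 2 * k.+1))
  else if n == 3 * k + 2 :> nat then U2 (omit a ord_max) s h
  else U5 a g.

Lemma Q_tupleE a s i h g (x := Q_tuple a s i h g) :
  [/\ forall l : 'I_k.+1, x (inord l) = U0 _ _ (sval a l),
      forall l : 'I_k.+1, x (inord (k.+1 + l)) = U11 _ (omit a l),
      forall l : 'I_k, x (inord (2 * k.+1 + l)) =
        U3 (omit a (widen_ord (leqnSn k) l)) s (i l)
    & x (inord (3 * k + 2)) = U2 (omit a ord_max) s h /\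
      x (inord (3 * k + 3)) = U5 a g].
Proof.
rewrite {}/x; split=> [l|l|l|].
- have lk := ltn_ord l; rewrite /Q_tuple inordK; last by lia.
  by rewrite inord_val lk.
- have lk := ltn_ord l; rewrite /Q_tuple inordK; last by lia.
  rewrite ifF ?ifT; [|lia|lia]; congr (U11 _ (omit a _)).
  by apply: val_inj; rewrite /= inordK; lia.
- have lk := ltn_ord l; rewrite /Q_tuple inordK; last by lia.
  rewrite ifF; last by lia.
  rewrite ifF; last by lia.
  rewrite ifT; last by lia.
  rewrite addKn; congr (U3 (omit a _) _ _).
  by apply: val_inj; rewrite /= inordK; lia.
- split; rewrite /Q_tuple inordK; try lia.
    rewrite ifF; last by lia.
    rewrite ifF; last by lia.
    by rewrite ifF ?eqxx //; lia.
  rewrite ifF; last by lia.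
  rewrite ifF; last by lia.
  rewrite ifF; last by lia.
  by rewrite ifF //; lia.
Qed.

Definition val3 (x : univ) : 'Z_2 := if x is U3 _ _ i then i else 0%R.
Definition val2 (x : univ) : H J k := if x is U2 _ _ h then h else zeroH J k.
Definition val5 (x : univ) : G lambda := if x is U5 _ g then g else zeroG lambda.

(** The isomorphism acts on the fibres over a tuple by b, d, e, which record
    the images of the zero elements.  On P_3 the action on a whole fibre is a
    translation, because the fibre has two elements.  The equation is the image of a Q_s relation with h = 0 and g = 0. *)
Lemma gauge_of_iso (c : inj_tuple J k.+1 -> 'Z_2) :
  0 < k -> isomorphic (twisted lambda c) (M lambda k J) ->
  exists (sigma : J -> J) (b : inj_tuple J k -> S -> 'Z_2)
    (d : inj_tuple J k -> S -> H J k) (e : inj_tuple J k.+1 -> G lambda),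
  injective sigma /\
  forall a s, exists2 v, (forall m, sval v m = sigma (sval a (lift ord0 m))) &
    (c a + \sum_(l < k) b (omit a (widen_ord (leqnSn k) l)) s =
     sval (d (omit a ord_max) s) v + sval (e a) s)%R.
Proof.
move=> k0 [f [/bij_inj finj ff fr]].
have f0 i : {j | f (U0 _ _ i) = U0 _ _ j}.
  apply: cid; have [_] := fr (P0 _) (fun=> U0 _ _ i).
  by apply; exists i.
have f3 u s i : exists v j, f (U3 u s i) = U3 v s j /\ f (U11 _ u) = U11 _ v.
  have [_] := fr (P3s s) (fun=> U3 u s i).
  case=> [|v [j /= fE]]; first by exists u, i.
  exists v, j; split=> //; have /= := ff (F3 _ _) (fun=> U3 u s i).
  by rewrite fE => -[->].
have f3D u s i : val3 (f (U3 u s i)) = (i + val3 (f (U3 u s 0%R)))%R.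
  have [->|/eqP/Z2_neq i1] := eqVneq i 0%R; first by rewrite add0r.
  rewrite addr0 in i1; have i0 : i <> 0%R by rewrite i1.
  have [v [j [fE uv]]] := f3 u s i; have [v' [j' [fE' uv']]] := f3 u s 0%R.
  rewrite fE fE' i1 /=; apply: Z2_neq => jj'; apply: i0.
  have vv' : v = v' by move: uv'; rewrite uv => -[].
  by have /finj [] : f (U3 u s i) = f (U3 u s 0%R) by rewrite fE fE' vv' jj'.
exists (fun i => sval (f0 i)), (fun u s => val3 (f (U3 u s 0%R))),
  (fun u s => val2 (f (U2 u s (zeroH J k)))), (fun a => val5 (f (U5 a (zeroG lambda)))).
split.
  move=> i i' ii'; have := svalP (f0 i'); rewrite -ii' -(svalP (f0 i)).
  by move/finj => [].
(* with h = 0 and g = 0 the sum of the i_l must equal c(a); the value is put on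
   the first of them *)
move=> a s; pose i n : 'Z_2 := if n == 0 then c a else 0%R.
have Qi : (\sum_(l < k) i l =
    sval (zeroH J k) (omit a ord0) + sval (zeroG lambda) s + c a)%R.
  rewrite /= !add0r (bigD1 (Ordinal k0)) //= big1 ?addr0 // => l.
  by rewrite -val_eqE /= /i => /negPf ->.
have [ea eu ei [eh eg]] := Q_tupleE a s i (zeroH J k) (zeroG lambda).
have [_] := fr (Q s) (Q_tuple a s i (zeroH J k) (zeroG lambda)).
case; first by exists a, (fun l : 'I_k => i l), (zeroH J k), (zeroG lambda).
move=> a' [i' [h' [g' [ea' _ ei' [eh' eg'] e']]]].
exists (omit a' ord0).
  move=> m /=; have := etrans (congr1 f (esym (ea (lift ord0 m)))) (ea' (lift ord0 m)).
  by case: (f0 _) => j /= -> [].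
have -> : val2 (f (U2 (omit a ord_max) s (zeroH J k))) = h'.
  by rewrite -eh (eh' : f _ = _).
have -> : val5 (f (U5 a (zeroG lambda))) = g' by rewrite -eg (eg' : f _ = _).
rewrite -e'; transitivity (\sum_(l < k) i l +
    \sum_(l < k) val3 (f (U3 (omit a (widen_ord (leqnSn k) l)) s 0%R)))%R.
  by rewrite Qi !add0r.
rewrite -big_split /=; apply: eq_bigr => l _; rewrite -f3D.
by rewrite -ei (ei' l : f _ = _).
Qed.

End Gauge.

(** * Faces of tuples *)

Lemma omit_omit (J : Type) n (q : inj_tuple J n.+2) (j j' : 'I_n.+2)
    (l l' : 'I_n.+1) :
  lift j l = j' -> lift j' l' = j -> omit (omit q j) l = omit (omit q j') l'.
Proof.
move=> /(congr1 val) /= jl /(congr1 val) /= jl'; apply: sig_eq; apply/funext => m /=.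
congr (sval q _); apply: val_inj; move: jl jl'; rewrite /= /bump; lia.
Qed.

(** Each unordered pair is counted twice. *)
Lemma sum_offdiag_sym n (F : 'I_n.+1 -> 'I_n.+1 -> 'Z_2) :
  (forall j j', F j j' = F j' j) -> (\sum_j \sum_(l < n) F j (lift j l) = 0)%R.
Proof.
move=> Fsym.
transitivity (\sum_(j : 'I_n.+1) \sum_(j' : 'I_n.+1 | (j' < j)%N) F j j' +
    \sum_(j : 'I_n.+1) \sum_(j' : 'I_n.+1 | (j < j')%N) F j j')%R.
  rewrite -big_split; apply: eq_bigr => j _ /=.
  transitivity (\sum_(j' | j' != j) F j j')%R.
    have e := @bigD1_ord 'Z_2 +%R 0%R _ j xpredT (F j) isT.
    rewrite (bigD1 j) // in e.
    by apply: (addrI (F j j)); exact: esym e.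
  rewrite (bigID (fun j' : 'I_n.+1 => j' < j)) /=.
  by congr (_ + _)%R; apply: eq_bigl => j'; rewrite -val_eqE /=; lia.
rewrite [X in (_ + X)%R](exchange_big_dep xpredT) //=.
under [X in (_ + X)%R]eq_bigr do under eq_bigr do rewrite Fsym.
exact: Z2_addxx.
Qed.

(** The boundary of a boundary vanishes; the last entry is never omitted. *)
Lemma sum_faces_faces (J : Type) k (b : inj_tuple J k -> 'Z_2) (q : inj_tuple J k.+2) :
  (\sum_(j < k.+1) \sum_(l < k) b (omit (omit q (widen_ord (leqnSn k.+1) j))
     (widen_ord (leqnSn k) l)) = 0)%R.
Proof.
pose F (j j' : 'I_k.+1) : 'Z_2 := if unlift j j' is Some l then
  b (omit (omit q (widen_ord (leqnSn k.+1) j)) (widen_ord (leqnSn k) l)) else 0%R.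
rewrite -[RHS](@sum_offdiag_sym k F) => [|j j'].
  by apply: eq_bigr => j _; apply: eq_bigr => l _; rewrite /F liftK.
rewrite /F; case: unliftP => [l jl|->]; last by rewrite unlift_none.
case: unliftP => [l' jl'|jj']; last by have := neq_lift j l; rewrite -jl jj' eqxx.
by congr b; apply: omit_omit; apply: val_inj;
  [rewrite [in RHS]jl|rewrite [in RHS]jl'].
Qed.

(** Finitely many elements of G vanish simultaneously somewhere, because frakD
    is a proper filter. *)
Lemma frakD_meet (lambda : Type) n (e : 'I_n -> G lambda) :
  exists s, forall j, sval (e j) s = 0%R.
Proof.
have u j : {u : finsubset lambda |
    forall v : finsubset lambda, sval u `<=` sval v -> sval (e j) v = 0%R}.
  by apply: cid; exact: (svalP (e j)).
have fin_u : finite_set (\bigcup_j sval (sval (u j))).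
  by apply: bigcup_finite => // j _; exact: (svalP (sval (u j))).
exists (exist _ _ fin_u) => j; apply: (svalP (u j)) => x ux.
by exists j.
Qed.

(** A twist that is not a coboundary: it has a nonzero sum over the faces of a
    tuple starting with p0. *)
Definition avoids (J : Type) (n : nat) (p0 : J) (a : inj_tuple J n) : 'Z_2 :=
  if `[< exists m, sval a m = p0 >] then 0%R else 1%R.

(** Only the face omitting q_0 avoids q_0. *)
Lemma sum_faces_avoids (J : Type) k (q : inj_tuple J k.+2) :
  (\sum_(j < k.+1) avoids (sval q ord0) (omit q (widen_ord (leqnSn k.+1) j)) = 1)%R.
Proof.
rewrite (bigD1 ord0) //= big1 => [|j j0].
  rewrite addr0 /avoids asboolF // => -[m /= /(svalP q)] /(congr1 val).
  by rewrite /= /bump.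
rewrite /avoids asboolT //; exists ord0 => /=; congr (sval q _); apply: val_inj.
by move: j0; rewrite -val_eqE /= /bump; lia.
Qed.

Lemma rcons_inj (J : Type) n (p : inj_tuple J n) x : (forall m, sval p m <> x) ->
  injective (fun m : 'I_n.+1 => if unlift ord_max m is Some m' then sval p m' else x).
Proof.
move=> px m m'; case: unliftP => [l ->|->]; case: unliftP => [l' ->|->] //.
- by move/(svalP p) ->.
- by move/px.
- by move/esym/px.
Qed.

Definition rcons_tuple (J : Type) n (p : inj_tuple J n) x
  (px : forall m, sval p m <> x) : inj_tuple J n.+1 := exist _ _ (rcons_inj px).

Lemma omit_rcons (J : Type) n (p : inj_tuple J n.+1) x
    (px : forall m, sval p m <> x) j :
  omit (omit (rcons_tuple px) (widen_ord (leqnSn n.+1) j)) ord_max = omit p j.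
Proof.
apply: sig_eq; apply/funext => m /=.
have -> : lift (widen_ord (leqnSn n.+1) j) (lift ord_max m) = lift ord_max (lift j m).
  by apply: val_inj; rewrite /= /bump; have := ltn_ord m; have := ltn_ord j; lia.
by rewrite liftK.
Qed.

(** * The twisted structure is not isomorphic to the standard one *)

Lemma embeds_finite_cover (L J X : Type) (A : X -> set J) : infinite_type L ->
  embeds X L -> (forall s, finite_set (A s)) -> (forall x, exists s, A s x) ->
  embeds J L.
Proof.
move=> Linf XL Afin Acover.
have s x : {s | A s x} := cid (Acover x).
have n t : {f : J -> nat | {in A t &, injective f}}.
  by apply: cid; apply/countable_injP; exact: finite_set_countable.
apply: embeds_trans (infinite_sqr Linf).
apply: (@embeds_trans _ (X * nat)); last first.
  by apply: embeds_prod => //; apply/card_le_typeP/infiniteP.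
exists (fun x => (sval (s x), sval (n (sval (s x))) x)) => x y [sxy].
rewrite -sxy => nxy; apply: (svalP (n (sval (s x)))) nxy; rewrite inE.
  exact: (svalP (s x)).
by rewrite sxy; exact: (svalP (s y)).
Qed.

(** The sets A s below collect the entries of p and the finitely many x
    that the summed equations allow at s. *)
Lemma twisted_avoids_not_iso lambda k J (p : inj_tuple J k.+1) : 0 < k ->
  infinite_type lambda ->
  isomorphic (twisted lambda (avoids (sval p ord0))) (M lambda k J) -> embeds J lambda.
Proof.
move=> k0 linf /gauge_of_iso[//|sigma [b [d [e [sinj E]]]]].
pose A (s : finsubset lambda) : set J := range (sval p) `|`
  \bigcup_(j : 'I_k.+1) \bigcup_(v in [set v | sval (d (omit p j) s) v <> 0%R])
    (sigma @^-1` range (sval v)).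
apply: (@embeds_finite_cover _ _ _ A) => //.
- exact: card_finsubset.
- move=> s; rewrite finite_setU; split; first exact: finite_image.
  apply: bigcup_finite => // j _; apply: bigcup_finite => [|v _].
    exact: (svalP (d (omit p j) s)).
  apply: finite_preimage; last exact: finite_image.
  by move=> x y _ _; exact: sinj.
move=> x; have [px|/forallNP px] := pselect (exists m, sval p m = x).
  by exists (exist _ set0 (@finite_set0 lambda)); left; case: px => m <-; exists m.
pose q := rcons_tuple px; pose face j := omit q (widen_ord (leqnSn k.+1) j).
(* the equations of the k+1 faces are summed at an s where no e contributes *)
have [s es] := frakD_meet (fun j => e (face j)).
exists s; right.
have qp0 : sval q ord0 = sval p ord0.
  rewrite /q /=; have -> : ord0 = lift ord_max (ord0 : 'I_k.+1) by exact: val_inj.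
  by rewrite liftK.
apply: contrapT => nA.
have : (\sum_(j < k.+1) avoids (sval p ord0) (face j) = 0)%R.
  rewrite -[RHS](sum_faces_faces (b^~ s) q); apply: eq_bigr => j _.
  have [v vE] := E (face j) s; rewrite es addr0 omit_rcons.
  have [->|/eqP dv] := eqVneq (sval (d (omit p j) s) v) 0%R; last first.
    case: nA; exists j => //; exists v => //.
    (* the last entry of the tuple v is the image of x *)
    have k1 : k.-1 < k by rewrite prednK.
    exists (Ordinal k1) => //; rewrite vE /=.
    set m := lift _ _; have -> : m = ord_max.
      by apply: val_inj; rewrite /= /bump; have := ltn_ord j; lia.
    by rewrite unlift_none.
  by move=> e0; apply: (@addIr 'Z_2 (\sum_(l < k)
    b (omit (face j) (widen_ord (leqnSn k) l)) s)%R); rewrite [LHS]e0 Z2_addxx.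
by rewrite -qp0 sum_faces_avoids.
Qed.

(** * Cardinality of the twisted structures *)

Section Cardinality.
Variables (lambda : Type) (k : nat) (J : Type).
Hypotheses (Jinf : infinite_type J).
Hypotheses (SJ : embeds (finsubset lambda) J) (GJ : embeds (G lambda) J).

Lemma embeds_tuple n : embeds (inj_tuple J n) (seq J).
Proof.
exists (fun u => [seq sval u i | i <- enum 'I_n]) => u v /eq_in_map uv.
by apply: sig_eq; apply/funext => i; apply: uv; rewrite mem_enum.
Qed.

Lemma embeds_H : embeds (H J k) J.
Proof.
have [t tinj] := embeds_trans (embeds_tuple k) (infinite_seq Jinf).
apply: embeds_trans (card_finsubset Jinf).
have fin_supp_t (h : H J k) : finite_set (t @` [set u | sval h u <> 0%R]).
  by apply: finite_image; exact: (svalP h).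
exists (fun h => exist _ _ (fin_supp_t h)) => h h' /(congr1 sval) /= hh'.
have E (f : H J k) u : (t @` [set u | sval f u <> 0%R]) (t u) <-> sval f u <> 0%R.
  by split=> [[u' fu' /tinj <-]|fu] //; exists u.
apply: sig_eq; apply/funext => u; have := E h u; rewrite hh' E.
case: (sval h u) (sval h' u) => [[|[|//]] ?] [[|[|//]] ?] e; apply: val_inj => //=.
  by case: e => e _; exfalso; apply: (e _ (val_inj _)).
by case: e => _ e; exfalso; apply: (e _ (val_inj _)).
Qed.

Lemma card_univ : embeds (univ lambda k J) J.
Proof.
have [tS Si] := SJ; have [tG Gi] := GJ; have [tH Hi] := embeds_H.
have [t ti] := embeds_tuple k; have [t' ti'] := embeds_tuple k.+1.
have natJ : embeds nat J by apply/card_le_typeP/infiniteP.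
apply: embeds_trans (infinite_sqr Jinf).
apply: (@embeds_trans _ (nat * (seq J * seq J))); last first.
  apply: embeds_prod natJ _; apply: embeds_trans (infinite_sqr Jinf).
  by apply: embeds_prod; exact: infinite_seq.
exists (fun x : univ lambda k J => match x with
  | U0 i => (0, ([:: i], [::]))
  | U11 u => (1, (t u, [::]))
  | U12 a => (2, (t' a, [::]))
  | U2 u s h => (3, (t u, [:: tS s; tH h]))
  | U4 h => (4, ([:: tH h], [::]))
  | U5 a g => (5, (t' a, [:: tG g]))
  | U3 u s i => (6 + i, (t u, [:: tS s]))
  end).
case=> [i|u|a|u s h|u s i|h|a g] [i'|u'|a'|u' s' h'|u' s' i'|h'|a' g'] //= [].
- by move=> ->.
- by move/ti ->.
- by move/ti' ->.
- by move=> /ti -> /Si -> /Hi ->.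
- by move=> /val_inj -> /ti -> /Si ->.
- by move/Hi ->.
- by move=> /ti' -> /Gi ->.
Qed.

End Cardinality.

Lemma embeds_beth (L : Type) m n : m <= n -> embeds (beth m L) (beth n L).
Proof.
move/subnKC <-; elim: (n - m) => [|d IH]; first by rewrite addn0; exists id.
rewrite addnS; apply: embeds_trans IH _ => /=.
exists (fun x y => `[< x = y >]) => x y /(congr1 (@^~ y)).
by rewrite (asboolT erefl) => /asboolP.
Qed.

(** * Non-categoricity *)

Theorem mainTheorem2 (lambda : Type) (k : nat) (I : Type)
    (hlambda : infinite_type lambda) (hk : 2 <= k) (hI : infinite_type I)
    (mu kappa : Type)
    (hmu : is_card_succ (beth k.+1 lambda) mu)
    (hkappa : card_le_type mu kappa) :
  ~ categorical (psi lambda k I) kappa.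
Proof.
have [[/card_le_typeP beth_mu mu_beth] _] := hmu.
have beth_kappa n : n <= k.+1 -> embeds (beth n lambda) kappa.
  move=> nk; apply: embeds_trans (embeds_beth lambda nk) _.
  by apply: embeds_trans beth_mu _; exact/card_le_typeP.
have lambda_kappa : embeds lambda kappa := beth_kappa 0 isT.
have kappa_inf : infinite_type kappa.
  apply/infiniteP/card_le_typeP; apply: embeds_trans lambda_kappa.
  exact/card_le_typeP/infiniteP.
have card_twisted (c : inj_tuple kappa k.+1 -> 'Z_2) :
    card_eq_type (twisted lambda c) kappa.
  rewrite /card_eq_type card_eq_le; apply/andP; split; last first.
    by apply/card_le_typeP; exists (fun i => U0 _ _ i) => i i' [].
  apply/card_le_typeP; apply: card_univ => //.
    exact: embeds_trans (card_finsubset hlambda) lambda_kappa.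
  exact: embeds_trans (card_G hlambda) (beth_kappa 1 isT).
move=> [N [_ _ Ncat]].
have [g ginj] : embeds nat kappa by apply/card_le_typeP/infiniteP.
have pinj : injective (fun m : 'I_k.+1 => g m) by move=> m m' /ginj /val_inj.
pose p : inj_tuple kappa k.+1 := exist _ _ pinj.
have iso (c : inj_tuple kappa k.+1 -> 'Z_2) : isomorphic N (twisted lambda c).
  by apply: Ncat => //; exact: twisted_models_psi.
apply: mu_beth; apply/card_le_typeP.
apply: (embeds_trans (B := kappa)); first exact/card_le_typeP.
apply: embeds_trans (embeds_beth lambda (leq0n k.+1)).
apply: (@twisted_avoids_not_iso lambda k kappa p) => //; first exact: ltnW.
rewrite -twisted0; exact: isomorphic_trans (isomorphic_sym (iso _)) (iso _).
Qed.
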